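(* Let $\Gamma$ be a connected finite graph, and let $\check L\mathcal M_\Gamma\subset L\mathcal M_\Gamma$ be the space of intrinsically robust loops. Then the image of the map $$Q:\check L\mathcal M_\Gamma\to H_1(\Gamma;\mathbb R),\qquad Q(\gamma)=\lim_{\beta\to\infty}Q_\beta(\gamma),$$ is contained in the integral lattice $H_1(\Gamma;\mathbb Z)\subset H_1(\Gamma;\mathbb R)$.
   Context: Graph. $\Gamma=(\Gamma_0,\Gamma_1)$ is a connected finite graph with vertex set $\Gamma_0$ and edge set $\Gamma_1$ (multiple edges and loop edges allowed). Fix a total ordering of $\Gamma_0$; the face maps $d_0,d_1:\Gamma_1\to\Gamma_0$ give the endpoints of an edge, with $d_0(\alpha)\le d_1(\alpha)$ and equality iff $\alpha$ is a loop edge. $C_i(\Gamma;\mathbb R)$ ($i=0,1$) is the real vector space with basis $\Gamma_i$; $\partial:C_1(\Gamma;\mathbb R)\to C_0(\Gamma;\mathbb R)$ is $\partial\alpha=d_0(\alpha)-d_1(\alpha)$ and $\partial^*$ is its adjoint for the standard inner products. $H_1(\Gamma;\mathbb R)=\ker\partial$, and $H_1(\Gamma;\mathbb Z)$ is the subgroup of cycles with integer coefficients. $\bar C_0(\Gamma;\mathbb R)$ (resp. $\tilde C_0(\Gamma;\mathbb R)$) is the set of $\mathbf p\in C_0(\Gamma;\mathbb R)$ with $\sum_i\mathbf p_i=1$ (resp. $=0$). Parameters. $\mathcal M_\Gamma$ is the real vector space of pairs $(E,W)$ of functions $E:\Gamma_0\to\mathbb R$, $W:\Gamma_1\to\mathbb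 R$. $L\mathcal M_\Gamma$ is the space of smooth unbased loops $\gamma$ in $\mathcal M_\Gamma$ (smooth 1-periodic maps, parametrized by $[0,1]$) with the Whitney $C^\infty$ topology. Current. For $\beta>0$ and $(E,W)\in\mathcal M_\Gamma$ let $\hat g$ be the diagonal operator on $C_1(\Gamma;\mathbb R)$ with entries $e^{\beta W_\alpha}$, $\hat\kappa$ the diagonal operator on $C_0(\Gamma;\mathbb R)$ with entries $e^{\beta E_i}$, and $H=-\partial\hat g^{-1}\partial^*\hat\kappa$ the master operator. For $\gamma\in L\mathcal M_\Gamma$ and $\tau_D>0$ sufficiently large, the master equation $\dot{\mathbf p}(t)=\tau_DH(\gamma(t))\mathbf p(t)$, $t\in[0,1]$, has a unique solution $\rho$ in $\bar C_0(\Gamma;\mathbb R)$ with $\rho(0)=\rho(1)$. Put $\mathbf J(t)=\tau_D\hat g^{-1}\partial^*\hat\kappa\rho(t)$, $Q(\beta,\tau_D,\gamma)=\int_0^1\mathbf J(t)\,dt$, and $Q_\beta(\gamma)=\lim_{\tau_D\to\infty}Q(\beta,\tau_D,\gamma)\in H_1(\Gamma;\mathbb R)$ (the analytic current map). Equivalently $Q_\beta(\gamma)=\int_0^1A(\gamma(t),\tfrac{d}{dt}\rho^B(\gamma(t)))\,dt$, where $\rho^B(E,W)=\left(\sum_je^{-\beta E_j}\right)^{-1}\sum_je^{-\beta E_j}j$ is the Boltzmann distribution and $A(E,W):\tilde C_0(\Gamma;\mathbb R)\to C_1(\Gamma;\mathbb R)$ is the inverse of the isomorphism $-\partial:\mathrm{im}(\hat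 g^{-1}\partial^* )\to\tilde C_0(\Gamma;\mathbb R)$ followed by inclusion. Robust loops. $\gamma\in L\mathcal M_\Gamma$ is intrinsically robust if there is an open neighborhood $U$ of $\gamma$ in $L\mathcal M_\Gamma$ such that $Q:=\lim_{\beta\to\infty}Q_\beta$ is well-defined and constant on $U$. $\check L\mathcal M_\Gamma$ is the subspace of intrinsically robust loops. *)

(* Defs.v *)
From HB Require Import structures.
From mathcomp Require Import all_boot all_order all_algebra.
From mathcomp Require Import all_classical all_reals all_analysis.

Set Implicit Arguments.
Unset Strict Implicit.
Unset Printing Implicit Defensive.

Import Order.TTheory GRing.Theory Num.Theory.
Import numFieldNormedType.Exports.

Local Open Scope classical_set_scope.
Local Open Scope ring_scope.

(** Finite multigraphs with loop edges. The totally ordered vertex set is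
    ['I_(nv G)] with its natural order, the edge set is ['I_(ne G)]. *)
Record graph := Graph {
  nv : nat;
  ne : nat;
  d0 : 'I_ne -> 'I_nv;
  d1 : 'I_ne -> 'I_nv;
  d0_le_d1 : forall a, (d0 a <= d1 a)%N }.

Definition adjacent (G : graph) : rel 'I_(nv G) :=
  fun i j => [exists a : 'I_(ne G),
    ((d0 a == i) && (d1 a == j)) || ((d0 a == j) && (d1 a == i))].

(** The empty graph is not connected. *)
Definition connected_graph (G : graph) : Prop :=
  (0 < nv G)%N /\ forall i j : 'I_(nv G), connect (@adjacent G) i j.


(** The column of an edge [a] is [d0 a - d1 a], hence 0 if [a] is a loop edge.
    The adjoint for the standard inner products is the transpose. *)
Definition boundary (R : realType) (G : graph) : 'M[R]_(nv G, ne G) :=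
  \matrix_(i, a) ((i == d0 a)%:R - (i == d1 a)%:R).

Definition H1_int (R : realType) (G : graph) : set 'cV[R]_(ne G) :=
  [set z | boundary R G *m z = 0 /\ forall a, z a 0 \is a Num.int].
Arguments H1_int R G : clear implicits.

(** Pairs [(E, W)] of a function on vertices and a function on edges. *)
Notation params R G := ('rV[R]_(nv G) * 'rV[R]_(ne G))%type.

Section Loops.
Variables (R : realType) (G : graph).

Record loop := Loop {
  loop_fun :> R -> params R G;
  loop_smooth : forall (k : nat) (t : R), derivable (derive1n k loop_fun) t 1;
  loop_periodic : forall t : R, loop_fun (t + 1) = loop_fun t }.

HB.instance Definition _ := gen_eqMixin loop.
HB.instance Definition _ := gen_choiceMixin loop.

Definition Ck_ball (g : loop) (k : nat) (e : R) : set loop :=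
  [set h | forall (j : nat) (t : R), (j <= k)%N -> `|derive1n j g t - derive1n j h t| < e].

(** The circle being compact, the Whitney topology is that of uniform
    convergence of all derivatives. *)
Definition whitney_open : set_system loop :=
  [set U | forall g, U g -> exists k, exists2 e : R, 0 < e & Ck_ball g k e `<=` U].

Lemma whitney_openT : whitney_open setT.
Proof. by move=> g _; exists 0%N, 1. Qed.

Lemma whitney_openI : setI_closed whitney_open.
Proof.
move=> A B oA oB g [/oA[k [e e0 kA]] /oB[l [d d0 lB]]].
exists (maxn k l), (Order.min e d); first by rewrite lt_min e0.
move=> h gh; split; [apply: kA|apply: lB] => j t jk.
- have := gh j t (leq_trans jk (leq_maxl _ _)).
  by rewrite lt_min => /andP[].
- have := gh j t (leq_trans jk (leq_maxr _ _)).
  by rewrite lt_min => /andP[].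
Qed.

Lemma whitney_open_bigU (I : Type) (f : I -> set loop) :
  (forall i, whitney_open (f i)) -> whitney_open (\bigcup_i f i).
Proof.
move=> of_ g [i _ fig]; have [k [e e0 kf]] := of_ i g fig.
by exists k, e => // h /kf fih; exists i.
Qed.

HB.instance Definition _ :=
  isOpenTopological.Build loop whitney_openT whitney_openI whitney_open_bigU.

End Loops.

Section Current.
Variables (R : realType) (G : graph).
Implicit Types (beta tau : R) (x : params R G) (g : loop R G).

Definition ghat beta x : 'M[R]_(ne G) :=
  diag_mx (map_mx (fun w => expR (beta * w)) x.2).

Definition kappahat beta x : 'M[R]_(nv G) :=
  diag_mx (map_mx (fun e => expR (beta * e)) x.1).

Definition master_operator beta x : 'M[R]_(nv G) :=
  - (boundary R G *m invmx (ghat beta x) *m (boundary R G)^T *m kappahat beta x).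

(** Only the values of [rho] on [[0, 1]] matter. Continuity up to the
    endpoints and the equation inside give the one-sided equations there. *)
Definition periodic_solution beta tau g (rho : R -> 'cV[R]_(nv G)) : Prop :=
  [/\ {within `[0, 1], continuous rho},
      forall t : R, t \in `]0, 1[ ->
        is_derive t 1 rho (tau *: (master_operator beta (g t) *m rho t)),
      forall t : R, t \in `[0, 1] -> \sum_i rho t i 0 = 1
    & rho 0 = rho 1].

Definition current_density beta tau g (rho : R -> 'cV[R]_(nv G)) (t : R) :
    'cV[R]_(ne G) :=
  tau *: (invmx (ghat beta (g t)) *m (boundary R G)^T *m
          kappahat beta (g t) *m rho t).

(** The three definitions below are graphs of partial functions: the relation
    says that the value is defined and equal to [q]. *)
Definition is_average_current beta tau g (q : 'cV[R]_(ne G)) : Prop :=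
  exists rho : R -> 'cV[R]_(nv G),
    [/\ periodic_solution beta tau g rho,
        forall rho', periodic_solution beta tau g rho' ->
          forall t : R, t \in `[0, 1] -> rho' t = rho t
      & q = \col_a (\int[lebesgue_measure]_(t in `[0, 1])
                      current_density beta tau g rho t a 0)].

Definition is_analytic_current beta g (q : 'cV[R]_(ne G)) : Prop :=
  exists2 Qtau : R -> 'cV[R]_(ne G),
    (\forall tau \near +oo, is_average_current beta tau g (Qtau tau)) &
    Qtau tau @[tau --> +oo] --> q.

Definition is_limit_current g (q : 'cV[R]_(ne G)) : Prop :=
  exists2 Qbeta : R -> 'cV[R]_(ne G),
    (\forall beta \near +oo, is_analytic_current beta g (Qbeta beta)) &
    Qbeta beta @[beta --> +oo] --> q.

Definition intrinsically_robust g : Prop :=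
  exists2 U : set (loop R G), open_nbhs g U &
    exists q, forall h, U h -> is_limit_current h q.

End Current.

(* Main.v *)
Require Import Defs.
From HB Require Import structures.
From mathcomp Require Import all_boot all_order all_algebra.
From mathcomp Require Import all_classical all_reals all_analysis.
From mathcomp Require Import ring lra.

Set Implicit Arguments.
Unset Strict Implicit.
Unset Printing Implicit Defensive.

Import Order.TTheory GRing.Theory Num.Theory.
Import numFieldNormedType.Exports.

Local Open Scope classical_set_scope.
Local Open Scope ring_scope.

(** Near a robust loop the limit current is constant, so it may be computed on
    any loop close to the given one.  Translate the loop by a small constant
    vector of the parameter space.  For a suitable translation there is a
    [d > 0] such that, at every time, all the energies [E i] are pairwise at
    distance at least [d], or else all the barriers [W a] are
    ([generic_shift]): a translation is bad only if it is close to one of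
    finitely many Lipschitz curves in a plane, and such curves cannot come near
    all the points of a fine enough grid.

    For the translated loop, let [rho] be a periodic solution and [J] its
    current.  Then [J] is the current in a resistor network with conductances
    [tau * exp (- beta W)] and potentials [exp (beta E) * rho], and its boundary
    is minus the derivative of [rho].  The average current is the integral of
    [J] over [[0, 1]].  Two limits have to be taken.

    - As [tau] tends to infinity, [rho] and its derivative converge uniformly
      to the Boltzmann distribution and its derivative ([adiabatic]).  Both
      statements follow from one energy estimate for periodic solutions of a
      forced, strongly dissipative equation ([periodic_relaxation]), applied
      first to the deviation from the Boltzmann distribution and then to the
      derivative of this deviation.

    - As [beta] tends to infinity, cut [[0, 1]] into short pieces.  Where the
      energies are separated, the Boltzmann distribution is exponentially close
      to the unit mass at the ground state, so its derivative, and with it the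
      current, is exponentially small ([ohm_current_le], [dboltz_gap]).  Where
      the barriers are separated, the current flows along the minimal spanning
      tree, and is therefore, up to an exponentially small error, an integral
      linear function of the derivative of [rho] that depends only on the order
      of the barriers ([tree_functional]).  So the current through an edge over
      a piece is close to an integral linear function of the increment of
      [rho].

    Summing by parts over the pieces leaves values of [rho] at the endpoints
    only.  At an endpoint the energies are separated, and [rho] is close to an
    integral vector, or they are not; in the latter case the barriers are
    separated on both adjacent pieces, the two integral functions agree, and
    the value of [rho] cancels.  Hence the total is close to an integer that
    does not depend on [beta] or [tau] ([quantization]). *)

(** * Elementary estimates and calculus on the unit interval *)

Lemma ler_sum_one (R : realType) (I : finType) (F : I -> R) (i : I) :
  (forall j, 0 <= F j) -> F i <= \sum_j F j.
Proof. by move=> F0; rewrite (bigD1 i) //= lerDl sumr_ge0. Qed.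

Lemma sum_le_card (R : realType) n (F : 'I_n -> R) (c : R) :
  (forall i, F i <= c) -> \sum_i F i <= n%:R * c.
Proof.
move=> Fc; apply: (le_trans (ler_sum _ (fun i _ => Fc i))).
by rewrite sumr_const card_ord mulr_natl.
Qed.

(** The derivative of the Boltzmann distribution grows like [beta]; this is what
    lets the exponentially small factors absorb it. *)
Lemma beta_expR_small (R : realType) (d e : R) : 0 < d -> 0 < e ->
  exists2 b0 : R, 1 <= b0 & forall beta, b0 <= beta -> beta * expR (- (beta * d)) <= e.
Proof.
move=> d0 e0; have c0 : 0 < 2 / (d ^+ 2 * e) by rewrite divr_gt0 // mulr_gt0 // exprn_gt0.
exists (1 + 2 / (d ^+ 2 * e)); first by rewrite lerDl ltW.
move=> beta bb; have b0 : 0 < beta by lra.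
have bd : 0 <= beta * d by rewrite mulr_ge0 ?ltW.
rewrite expRN ler_pdivrMr ?expR_gt0 //.
have := expR_ge1Dxn 1 bd; rewrite (_ : 2`!%:R = 2) // => h.
apply: (@le_trans _ _ (e * ((beta * d) ^+ 2 / 2))); last by rewrite ler_pM2l //; lra.
rewrite (_ : e * _ = beta * (beta * (d ^+ 2 * e / 2))); last by ring.
rewrite ler_peMr ?(ltW b0) //.
have : 2 / (d ^+ 2 * e) * (d ^+ 2 * e / 2) <= beta * (d ^+ 2 * e / 2).
  apply: ler_wpM2r; last by lra.
  by rewrite divr_ge0 // mulr_ge0 ?sqr_ge0 // ltW.
by rewrite (_ : 2 / _ * _ = 1) //; field; rewrite !gt_eqF.
Qed.

Section Calculus.
Variable R : realType.
Implicit Types f g : R -> R.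

Lemma is_deriveSum n (h : 'I_n -> R -> R) (dh : 'I_n -> R) (t : R) :
  (forall i, is_derive t 1 (h i) (dh i)) ->
  is_derive t 1 (fun x => \sum_i h i x) (\sum_i dh i).
Proof.
move=> H; rewrite (_ : (fun x => _) = \sum_i h i); first exact: is_derive_sum.
by apply/funext => x; rewrite fct_sumE.
Qed.

Lemma is_deriveMul f g (df dg t : R) :
  is_derive t 1 f df -> is_derive t 1 g dg ->
  is_derive t 1 (fun x => f x * g x) (df * g t + f t * dg).
Proof.
move=> Df Dg; have := is_deriveM Df Dg => H.
by apply: is_derive_eq; rewrite addrC /GRing.scale /= [g t * _]mulrC.
Qed.

Lemma is_derive_expM f (df beta t : R) :
  is_derive t 1 f df ->
  is_derive t 1 (fun x => expR (beta * f x)) (beta * df * expR (beta * f t)).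
Proof.
move=> Df; have D1 : is_derive t 1 (fun x => beta * f x) (beta * df).
  by have := is_deriveMul (is_derive_cst beta t 1) Df; rewrite mul0r add0r.
have := @is_derive1_comp R expR (fun x => beta * f x) t _ _ (is_derive_expR _) D1.
by rewrite mulrC.
Qed.

Lemma is_deriveInv f (df t : R) : f t != 0 ->
  is_derive t 1 f df -> is_derive t 1 (fun x => (f x)^-1) (- df / f t ^+ 2).
Proof.
by move=> f0 Df; have := is_deriveV f0 Df; rewrite /GRing.scale /= mulNr mulrC -mulNr.
Qed.

Lemma within_continuousP f (A : set R) : {within A, continuous f} <->
  forall x, A x -> forall e, 0 < e ->
    exists2 d, 0 < d & forall y, A y -> `|x - y| < d -> `|f x - f y| < e.
Proof.
split=> [/subspace_continuousP cf x Ax e e0|H].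
  have /cvgrPdist_lt /(_ e e0) := cf x Ax; rewrite near_withinE.
  by move=> /nbhs_ballP[d /= d0 H]; exists d => // y Ay xy; apply: H.
apply/subspace_continuousP => x Ax; apply/cvgrPdist_lt => e e0.
have [d d0 {}H] := H x Ax e e0; rewrite near_withinE.
by apply/nbhs_ballP; exists d => //= y xy Ay; exact: H.
Qed.

(** A periodic function that decreases wherever it exceeds [F0] never exceeds
    [F0].  Periodicity moves a maximum at 0 to 1, so that there is an interval
    to the left of the maximum on which the function would have to decrease. *)
Lemma periodic_le (F dF : R -> R) (F0 : R) :
  {within `[0, 1], continuous F} ->
  (forall t : R, t \in `]0, 1[ -> is_derive t 1 F (dF t)) -> F 0 = F 1 ->
  (forall t : R, t \in `]0, 1[ -> F0 < F t -> dF t < 0) ->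
  forall t : R, t \in `[0, 1] -> F t <= F0.
Proof.
move=> cF DF F01 dec t t01; rewrite leNgt; apply/negP => FF.
have [c0 c001 maxc0] := EVT_max (@ler01 R) cF.
have [c [c0' c1 maxc]] : exists c, [/\ 0 < c, c <= 1 & forall t : R, t \in `[0, 1] -> F t <= F c].
  have [c00|c00] := eqVneq c0 0.
    by exists 1; split => // x x01; rewrite -F01 -c00 maxc0.
  exists c0; split => //; last by rewrite (itvP c001).
  by rewrite lt_neqAle eq_sym c00 (itvP c001).
have c01 : c \in `[0, 1] by rewrite in_itv /= (ltW c0').
have Fc : 0 < F c - F0 by rewrite subr_gt0; exact: lt_le_trans FF (maxc _ t01).
have [d d0 Hd] := (within_continuousP F `[0, 1]).1 cF c c01 _ Fc.
(* [F] stays above [F0] on [[s, c]], hence decreases there. *)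
pose s := Num.max 0 (c - d / 2).
have s0 : 0 <= s by rewrite le_max lexx.
have sc : s < c by rewrite gt_max c0' /=; lra.
have sd : c - d / 2 <= s by rewrite le_max lexx orbT.
have sub x : x \in `[s, c] -> x \in `[0, 1].
  by rewrite !in_itv /= => /andP[? ?]; apply/andP; split; lra.
have DFs x : x \in `]s, c[ -> is_derive x 1 F (dF x).
  by rewrite in_itv /= => /andP[? ?]; apply: DF; rewrite in_itv /=; apply/andP; split; lra.
have cFs : {within `[s, c], continuous F}.
  by apply: continuous_subspaceW cF => x /= /sub.
have [x xsc] := MVT sc DFs cFs.
apply/eqP; rewrite gt_eqF //.
apply: (@lt_le_trans _ _ 0); last by rewrite subr_ge0 maxc // sub // in_itv /= lexx ltW.
rewrite nmulr_rlt0 ?subr_gt0 //; apply: dec.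
  by move: xsc; rewrite !in_itv /= => /andP[? ?]; apply/andP; split; lra.
have := Hd x; move: xsc; rewrite in_itv /= => /andP[sx xc].
rewrite ger0_norm ?subr_ge0 ?(ltW xc) // => Hx.
have x01 : x \in `[0, 1].
  by apply: sub; rewrite in_itv /= !ltW.
have : c - x < d by lra.
move=> cxd; have := Hx x01 cxd; rewrite ltr_norml => /andP[_]; lra.
Qed.

Lemma within_continuousD f g (A : set R) : {within A, continuous f} ->
  {within A, continuous g} -> {within A, continuous (fun x => f x + g x)}.
Proof. by move=> cf cg x; apply: continuousD; [exact: cf|exact: cg]. Qed.

Lemma within_continuousM f g (A : set R) : {within A, continuous f} ->
  {within A, continuous g} -> {within A, continuous (fun x => f x * g x)}.
Proof. by move=> cf cg x; apply: continuousM; [exact: cf|exact: cg]. Qed.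

Lemma within_continuousN f (A : set R) : {within A, continuous f} ->
  {within A, continuous (fun x => - f x)}.
Proof. by move=> cf x; apply: continuousN; exact: cf. Qed.

Lemma within_continuous_sum (I : Type) (r : seq I) (f : I -> R -> R) (A : set R) :
  (forall i, {within A, continuous (f i)}) ->
  {within A, continuous (fun x => \sum_(i <- r) f i x)}.
Proof.
move=> cf; elim: r => [|i r IH].
  rewrite (_ : (fun x => _) = (fun=> 0)); first by move=> x; exact: cst_continuous.
  by apply/funext => x; rewrite big_nil.
rewrite (_ : (fun x => _) = (fun x => f i x + \sum_(i <- r) f i x)).
  exact: within_continuousD.
by apply/funext => x; rewrite big_cons.
Qed.

Lemma derivable_within f (df : R -> R) (A : set R) :
  (forall t : R, is_derive t 1 f (df t)) -> {within A, continuous f}.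
Proof.
move=> Df; apply: continuous_subspaceT => t.
by apply: differentiable_continuous; apply/derivable1_diffP; case: (Df t).
Qed.

Lemma within_bounded f : {within `[0, 1], continuous f} ->
  exists2 M, 0 < M & forall t : R, t \in `[0, 1] -> `|f t| <= M.
Proof.
move=> cf; have [c _ Hc] := EVT_max (@ler01 R) cf.
have [c' _ Hc'] := EVT_min (@ler01 R) cf.
exists (`|f c| + `|f c'| + 1); first by rewrite ltr_pwDr // addr_ge0.
move=> t t01; rewrite ler_norml; have := Hc t t01; have := Hc' t t01.
have := ler_norm (f c); have := ler_norm (- f c'); rewrite normrN => *.
have := normr_ge0 (f c); have := normr_ge0 (f c') => *.
by apply/andP; split; lra.
Qed.

End Calculus.

Lemma within_bounded_family (R : realType) (I : finType) (f : I -> R -> R) :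
  (forall i, {within `[0, 1], continuous (f i)}) ->
  exists2 M, 0 <= M & forall i (t : R), t \in `[0, 1] -> `|f i t| <= M.
Proof.
move=> cf; have /choice[M MP] i : exists M, 0 <= M /\ forall t : R, t \in `[0, 1] -> `|f i t| <= M.
  by have [M M0 H] := within_bounded (cf i); exists M; split => //; exact: ltW.
exists (\sum_i M i); first by apply: sumr_ge0 => i _; have [] := MP i.
move=> i t t01; apply: le_trans ((MP i).2 t t01) _.
by apply: (ler_sum_one (F := M)) => j; have [] := MP j.
Qed.

Lemma derivable_lipschitz (R : realType) (f df : R -> R) (L : R) :
  (forall t : R, is_derive t 1 f (df t)) ->
  (forall t : R, t \in `[0, 1] -> `|df t| <= L) ->
  forall s t : R, s \in `[0, 1] -> t \in `[0, 1] -> `|f s - f t| <= L * `|s - t|.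
Proof.
move=> Df dfL; have le_case (s t : R) : s \in `[0, 1] -> t \in `[0, 1] -> s <= t ->
    `|f s - f t| <= L * `|s - t|.
  move=> s01 t01 st.
  have Dst x : x \in `]s, t[ -> is_derive x 1 f (df x) by [].
  have [c cst] := MVT_segment st Dst (derivable_within Df).
  rewrite distrC => ->; rewrite normrM [`|t - s|]distrC ler_wpM2r // dfL //.
  move: cst s01 t01; rewrite !in_itv /= => /andP[? ?] /andP[? ?] /andP[? ?].
  by apply/andP; split; lra.
move=> s t s01 t01; have [st|/ltW ts] := leP s t; first exact: le_case.
by rewrite distrC [`|s - t|]distrC le_case.
Qed.

(** The functionals [u] of interest are the coordinates of vectors and of pairs
    of vectors. *)
Lemma is_derive_functional (R : realType) (V : normedModType R) (f : R -> V) (u : V -> R)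
    (t : R) (l : V) :
  (forall x y, u (x - y) = u x - u y) -> (forall k x, u (k *: x) = k * u x) ->
  continuous u -> is_derive t 1 f l -> is_derive t 1 (fun x => u (f x)) (u l).
Proof.
move=> uB uZ cu [df dfl].
have cf : (fun h => h^-1 *: (f (h *: (1 : R) + t) - f t)) @ 0^' --> l.
  by rewrite -dfl; exact: df.
have cuf : (fun h => h^-1 *: (u (f (h *: (1 : R) + t)) - u (f t))) @ 0^' --> u l.
  rewrite (_ : (fun h => _) = u \o (fun h => h^-1 *: (f (h *: (1 : R) + t) - f t))).
    exact: continuous_cvg (cu l) cf.
  by apply/funext => h /=; rewrite uZ uB.
by apply: DeriveDef; [exact: cvgP cuf|exact: cvg_lim cuf].
Qed.

Lemma within_continuous_comp (R : realType) (V : topologicalType) (f : R -> V) (u : V -> R)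
    (A : set R) : {within A, continuous f} -> continuous u ->
  {within A, continuous (fun x => u (f x))}.
Proof.
move=> /subspace_continuousP cf cu; apply/subspace_continuousP => x Ax.
exact: cvg_comp (cf x Ax) (cu _).
Qed.

Lemma derive1n_shift (R : realType) (V : normedModType R) (f : R -> V) (p : V) k :
  derive1n k.+1 (fun t => f t + p) = derive1n k.+1 f.
Proof.
rewrite !derive1Sn; congr (derive1n k _); apply/funext => t; rewrite /derive1.
rewrite (_ : (fun h => _) = (fun h => h^-1 *: (f (h + t) - f t))) //.
by apply/funext => h; rewrite opprD addrACA subrr addr0.
Qed.

Lemma primitive (R : realType) (f : R -> R) : {within `[0, 1], continuous f} ->
  exists P : R -> R, [/\ {within `[0, 1], continuous P},
    forall t : R, t \in `]0, 1[ -> is_derive t 1 P (f t) &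
    P 1 - P 0 = \int[lebesgue_measure]_(t in `[0, 1]) f t].
Proof.
move=> cf.
have intf := continuous_compact_integrable (@segment_compact R 0 1) cf.
have [cin _ _] := (continuous_within_itvP f ltr01).1 cf.
exists (fun x => \int[lebesgue_measure]_(t in `[0, x]) f t); split.
- exact: parameterized_integral_continuous intf.
- move=> t t01; have [|||D1 D2] := @continuous_FTC1_closed R f 0 t 1 _ intf.
  + by rewrite (itvP t01).
  + by rewrite (itvP t01).
  + by apply: cin; rewrite inE.
  by apply: DeriveDef => //; rewrite -derive1E.
- by rewrite set_itv1 Rintegral_set1 subr0.
Qed.

Lemma pinfty_witness (R : realType) (b : R) (P Q : set R) :
  (\forall x \near +oo, P x) -> (\forall x \near +oo, Q x) ->
  exists x, [/\ b <= x, P x & Q x].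
Proof.
move=> nP nQ; have nb := nbhs_pinfty_ge (num_real b).
by have [x [[bx Px] Qx]] := filter_ex (filterI (filterI nb nP) nQ); exists x.
Qed.

Lemma coord_le_norm (R : realType) m (v : 'cV[R]_m) a : `|v a 0| <= `|v|.
Proof.
rewrite [leRHS]/Num.Def.normr /= mx_normrE.
exact: (le_bigmax _ (fun ij => `|v ij.1 ij.2|) (a, 0)).
Qed.

Lemma invmx_diag (R : realType) n (u v : 'rV[R]_n) :
  (forall i, u 0 i * v 0 i = 1) -> invmx (diag_mx u) = diag_mx v.
Proof.
move=> uv; have uvE : diag_mx u *m diag_mx v = 1%:M.
  by apply/matrixP => i j; rewrite mul_diag_mx !mxE; case: eqP => [->|];
    rewrite ?mulr1n ?uv // mulr0n mulr0.
have [uu _] := mulmx1_unit uvE.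
by rewrite -[invmx _]mulmx1 -uvE mulmxA mulVmx // mul1mx.
Qed.

(** * Currents in a resistor network *)

Section GraphFlow.
Variables (R : realType) (G : graph).
Implicit Types (phi : 'I_(nv G) -> R) (J w : 'I_(ne G) -> R).

(** The boundary of the chain [J]: the net amount that leaves each vertex when
    an edge is directed from [d0] to [d1]. *)
Definition flux J (i : 'I_(nv G)) : R :=
  \sum_a ((i == d0 a)%:R - (i == d1 a)%:R) * J a.

Definition grad phi (a : 'I_(ne G)) : R := phi (d0 a) - phi (d1 a).

(** Both with an indicator function, to count the flux out of a set of vertices,
    and with a potential, to compute the dissipated energy. *)
Lemma flux_grad phi J : \sum_i phi i * flux J i = \sum_a grad phi a * J a.
Proof.
rewrite /flux; under eq_bigr do rewrite mulr_sumr.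
rewrite exchange_big /=; apply: eq_bigr => a _.
under eq_bigr do rewrite mulrA.
rewrite -mulr_suml; congr (_ * _); rewrite /grad.
under eq_bigr do rewrite mulrBr.
rewrite sumrB; congr (_ - _).
- by rewrite (bigD1 (d0 a)) //= eqxx mulr1 big1 ?addr0 // => i /negbTE ->; rewrite mulr0.
- by rewrite (bigD1 (d1 a)) //= eqxx mulr1 big1 ?addr0 // => i /negbTE ->; rewrite mulr0.
Qed.

(** The bound does not depend on the conductances.  Cut the graph at the level
    set of the potential through the upper endpoint of [a]: every edge across
    the cut carries current in the same direction, out of the level set, so the
    current through [a] is at most the total flux out of it. *)
Lemma ohm_current_le phi w (a : 'I_(ne G)) : (forall b, 0 < w b) ->
  `|w a * grad phi a| <= \sum_i `|flux (fun b => w b * grad phi b) i|.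
Proof.
move=> w0; set J := (fun b => w b * grad phi b).
(* [chi] is the indicator function of the level set. *)
pose m := Num.max (phi (d0 a)) (phi (d1 a)).
pose chi i : R := (m <= phi i)%R%:R.
have pos b : 0 <= grad chi b * J b.
  rewrite /grad /chi /J mulrCA mulr_ge0 ?(ltW (w0 b)) // /grad.
  case: (leP m (phi (d0 b))) => h0; case: (leP m (phi (d1 b))) => h1 /=; rewrite /=; lra.
have -> : `|w a * grad phi a| = grad chi a * J a.
  rewrite normrM gtr0_norm // /J mulrCA; congr (_ * _).
  rewrite /grad /chi /m; case: (ltgtP (phi (d0 a)) (phi (d1 a))) => h.
  - by rewrite lexx leNgt h /= ltr0_norm ?subr_lt0 //; lra.
  - by rewrite lexx leNgt h /= gtr0_norm ?subr_gt0 //; lra.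
  - by rewrite h subrr normr0 mulr0.
apply: (le_trans (ler_sum_one (F := fun b => grad chi b * J b) a pos)).
rewrite -flux_grad; apply: ler_sum => i _.
rewrite /chi; case: (m <= phi i); rewrite ?mul1r ?mul0r ?normr_ge0 //.
exact: ler_norm.
Qed.

(** Sum the potential differences along a path without repeated vertices. *)
Lemma connect_potential_le (e : rel 'I_(nv G)) phi (m : R) i j : 0 <= m ->
  (forall k l, e k l -> `|phi k - phi l| <= m) -> connect e i j ->
  `|phi i - phi j| <= (nv G)%:R * m.
Proof.
move=> m0 em /connectP[p0 ep0 ->]; case: (shortenP ep0) => p ep up _.
have : (size p <= nv G)%N.
  have := max_card (mem (i :: p)); rewrite (card_uniqP up) card_ord /= => h.
  exact: ltnW.
suff h : `|phi i - phi (last i p)| <= (size p)%:R * m.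
  by move=> sp; apply: (le_trans h); rewrite ler_wpM2r // ler_nat.
elim: p i ep {up ep0} => [|k p IH] i /=; first by rewrite subrr normr0 mul0r.
move=> /andP[ik kp]; have -> : phi i - phi (last k p) =
  (phi i - phi k) + (phi k - phi (last k p)) by ring.
apply: (le_trans (ler_normD _ _)); rewrite -natr1 mulrDl mul1r addrC.
by rewrite lerD ?IH // em.
Qed.

(** When each edge conducts much better than every edge above it for the order
    [o], the current is carried by the minimal spanning tree of [o] and is given
    by integral functionals of the flux, up to a multiple of the ratio [x].

    The functional of an edge [a] is built by induction, from the top of the
    order.  If the edges below [a] connect its endpoints, they short-circuit
    [a]: the potential difference across [a] is a sum of differences across
    these much better conductors, and the functional is 0.  Otherwise let [S] be
    the component of [d0 a] in the graph of the edges below [a].  The flux out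
    of [S] is the current through [a] plus the currents, with coefficients 0, 1
    or -1, through edges above [a], for which functionals are known. *)
Lemma tree_functional (o : rel 'I_(ne G)) :
  irreflexive o -> transitive o -> (forall a b, a != b -> o a b || o b a) ->
  exists (l : 'I_(ne G) -> 'I_(nv G) -> int) (C : 'I_(ne G) -> R),
   forall a, 0 <= C a /\
   forall (w : 'I_(ne G) -> R) phi (x : R), (forall b, 0 < w b) -> 0 <= x ->
    (forall a b, o b a -> w a <= x * w b) ->
    `|w a * grad phi a
      - \sum_i (l a i)%:~R * flux (fun b => w b * grad phi b) i|
    <= C a * x * \sum_i `|flux (fun b => w b * grad phi b) i|.
Proof.
move=> oirr otr otot.
pose bnd (a : 'I_(ne G)) (lC : ('I_(nv G) -> int) * R) := 0 <= lC.2 /\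
   forall (w : 'I_(ne G) -> R) phi (x : R), (forall b, 0 < w b) -> 0 <= x ->
    (forall a b, o b a -> w a <= x * w b) ->
    `|w a * grad phi a
      - \sum_i (lC.1 i)%:~R * flux (fun b => w b * grad phi b) i|
    <= lC.2 * x * \sum_i `|flux (fun b => w b * grad phi b) i|.
suff /choice[lC lCP] : forall a, exists lC, bnd a lC.
  by exists (fun a => (lC a).1), (fun a => (lC a).2) => a; exact: lCP.
move=> a; have [k] := ubnP #|[pred b | o a b]|; elim: k a => // k IH a.
rewrite ltnS => ak.
(* The induction hypothesis, with functionals and constants chosen for all the
   edges above [a] at once. *)
have /choice[lC lCP] b : exists lC, o a b -> bnd b lC.
  have [oab|noab] := boolP (o a b); last by exists (fun=> 0, 0).
  have [|lC H] := IH b; last by exists lC.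
  apply: leq_trans ak; apply: proper_card; apply/properP; split.
    by apply/fintype.subsetP => c; rewrite !inE; apply: otr.
  by exists b; rewrite !inE ?oab ?oirr.
(* Adjacency by edges below [a]. *)
pose light i j := [exists b, o b a &&
  (((d0 b == i) && (d1 b == j)) || ((d0 b == j) && (d1 b == i)))].
have lightP b : o b a -> light (d0 b) (d1 b) /\ light (d1 b) (d0 b).
  by move=> ob; split; apply/existsP; exists b; rewrite ob !eqxx ?orbT.
have [con|ncon] := boolP (connect light (d0 a) (d1 a)).
  exists (fun=> 0, (nv G)%:R); split=> [/=|w phi x w0 x0 wx /=]; first exact: ler0n.
  rewrite [X in _ - X]big1 ?subr0 => [|i _]; last by rewrite mul0r.
  set S := \sum_i _.
  have S0 : 0 <= S by apply: sumr_ge0.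
  rewrite normrM gtr0_norm // mulrC -ler_pdivlMr // -!mulrA.
  apply: (@connect_potential_le light) con.
    by rewrite !mulr_ge0 // invr_ge0 ltW.
  have key b : o b a -> `|phi (d0 b) - phi (d1 b)| <= x * (S / w a).
    move=> ob; have := ohm_current_le phi b w0; rewrite -/S normrM gtr0_norm // => h.
    rewrite mulrA ler_pdivlMr // mulrC.
    apply: le_trans (_ : x * w b * `|grad phi b| <= _).
      by rewrite ler_wpM2r // wx.
    by rewrite -mulrA ler_wpM2l.
  move=> i j /existsP[b /andP[ob /orP[]/andP[/eqP<- /eqP<-]]]; first exact: key.
  by rewrite distrC; exact: key.
(* [chi] is the indicator function of the component [S] of [d0 a]. *)
pose chi i : int := (connect light (d0 a) i)%R%:R.
pose gchi b := chi (d0 b) - chi (d1 b).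
have gchi1 b : `|(gchi b)%:~R| <= 1 :> R.
  by rewrite /gchi /chi; case: connect; case: connect;
    rewrite ?subrr ?subr0 ?sub0r ?normr0 ?normrN ?normr1.
have gchiE b : (gchi b)%:~R = grad (fun i => (chi i)%:~R) b :> R.
  by rewrite /gchi rmorphB.
have gchia : gchi a = 1 by rewrite /gchi /chi connect0 (negbTE ncon) subr0.
have gchil b : o b a -> gchi b = 0.
  move=> /lightP[l1 l2]; rewrite /gchi /chi.
  suff -> : connect light (d0 a) (d0 b) = connect light (d0 a) (d1 b) by rewrite subrr.
  by apply/idP/idP => h; apply: (connect_trans h); exact: connect1.
exists (fun i => chi i - \sum_(b | o a b) gchi b * (lC b).1 i,
        \sum_(b | o a b) (lC b).2); split=> /=.
  by apply: sumr_ge0 => b /lCP[].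
move=> w phi x w0 x0 wx; set J := (fun b => w b * grad phi b).
have Ja : J a = \sum_i (chi i)%:~R * flux J i - \sum_(b | o a b) (gchi b)%:~R * J b.
  rewrite flux_grad (bigD1 a) //= -gchiE gchia mul1r.
  rewrite (bigID (fun b => o a b)) /= [X in _ + (_ + X)]big1 => [|b]; last first.
    move=> /andP[ba nab]; rewrite -gchiE gchil ?mul0r //.
    by have := otot _ _ ba; rewrite (negbTE nab) orbF.
  rewrite addr0 [X in _ + X - _](eq_bigl (fun b => o a b)) => [|b].
    by under [in RHS]eq_bigr do rewrite -gchiE; rewrite addrK.
  by case: eqVneq => //= ->; rewrite oirr.
have -> : w a * grad phi a - \sum_i (chi i - \sum_(b | o a b) gchi b * (lC b).1 i)%:~R * flux J i
  = - \sum_(b | o a b) (gchi b)%:~R * (J b - \sum_i ((lC b).1 i)%:~R * flux J i).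
  have -> : \sum_i (chi i - \sum_(b | o a b) gchi b * (lC b).1 i)%:~R * flux J i =
      \sum_i (chi i)%:~R * flux J i
      - \sum_(b | o a b) (gchi b)%:~R * \sum_i ((lC b).1 i)%:~R * flux J i.
    rewrite [X in _ = _ - X](_ : _ = \sum_i \sum_(b | o a b)
        (gchi b)%:~R * (((lC b).1 i)%:~R * flux J i)); last first.
      by rewrite exchange_big /=; apply: eq_bigr => b _; rewrite mulr_sumr.
    rewrite -sumrB; apply: eq_bigr => i _.
    rewrite rmorphB mulrBl rmorph_sum /= mulr_suml; congr (_ - _).
    by apply: eq_bigr => b _; rewrite rmorphM /= mulrA.
  rewrite -[w a * _]/(J a) Ja; under [in RHS]eq_bigr do rewrite mulrBr.
  by rewrite sumrB; ring.
rewrite normrN; apply: le_trans (ler_norm_sum _ _ _) _.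
rewrite 2!mulr_suml; apply: ler_sum => b oab.
have [C0 h] := lCP b oab.
rewrite normrM; apply: le_trans (h w phi x w0 x0 wx).
by rewrite ler_piMl.
Qed.
End GraphFlow.

Lemma connected_potential_le (R : realType) (G : graph) (phi : 'I_(nv G) -> R) (m : R) :
  connected_graph G -> 0 <= m -> (forall a, `|grad phi a| <= m) ->
  forall i j, `|phi i - phi j| <= (nv G)%:R * m.
Proof.
move=> [_ con] m0 gm i j; apply: connect_potential_le (con i j) => // k l.
by case/existsP => a /orP[]/andP[/eqP<- /eqP<-]; [|rewrite distrC]; exact: gm.
Qed.

(** * Relaxation of periodically driven diffusions *)

(** The weighted graph Laplacian with conductances [w]. *)
Definition laplacian (R : realType) (G : graph) (w : 'I_(ne G) -> R)
    (phi : 'I_(nv G) -> R) (i : 'I_(nv G)) : R :=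
  flux (fun a => w a * grad phi a) i.

(** The operator [eta |-> laplacian w (kap * eta)] is symmetric and positive for
    the inner product weighted by [kap], and definite on vectors of sum 0
    because the graph is connected.  So for large [tau] the energy, the sum of
    the [kap i * eta i ^ 2], decreases as soon as it exceeds a multiple of
    [(K / tau) ^ 2]; by periodicity it never exceeds that multiple. *)
Lemma periodic_relaxation (R : realType) (G : graph)
    (kap dkap : 'I_(nv G) -> R -> R) (w : 'I_(ne G) -> R -> R) (k0 K1 w0 : R) :
  connected_graph G -> 0 < k0 -> 0 < w0 -> 0 <= K1 ->
  (forall i (t : R), is_derive t 1 (kap i) (dkap i t)) ->
  (forall i (t : R), t \in `[0, 1] -> k0 <= kap i t /\ `|dkap i t| <= K1) ->
  (forall a (t : R), t \in `[0, 1] -> w0 <= w a t) ->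
  (forall i, kap i 0 = kap i 1) ->
  exists C tau0 : R, [/\ 0 <= C, 0 < tau0 &
  forall tau K (eta f : 'I_(nv G) -> R -> R), tau0 <= tau -> 0 <= K ->
   (forall i, {within `[0, 1], continuous (eta i)}) ->
   (forall i (t : R), t \in `]0, 1[ -> is_derive t 1 (eta i)
      (- tau * laplacian (w^~ t) (fun j => kap j t * eta j t) i + f i t)) ->
   (forall i (t : R), t \in `]0, 1[ -> `|f i t| <= K) ->
   (forall t : R, t \in `]0, 1[ -> \sum_i eta i t = 0) ->
   (forall i, eta i 0 = eta i 1) ->
   forall i (t : R), t \in `[0, 1] -> `|eta i t| <= C * K / tau].
Proof.
move=> con k00 w00 K10 Dkap kapb wb kapP.
pose n : R := (nv G)%:R.
have n1 : 1 <= n by rewrite /n ler1n; case: con.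
have n0 : 0 <= n by lra.
pose tau0 := n ^+ 3 * K1 / (k0 ^+ 2 * w0) + 1.
have tau00 : 0 < tau0.
  rewrite /tau0 ltr_wpDl // divr_ge0 ?mulr_ge0 ?exprn_ge0 ?(ltW w00) ?(ltW k00) //.
exists (2 * n ^+ 4 / (w0 * k0)), tau0; split => //.
  by rewrite divr_ge0 ?mulr_ge0 ?exprn_ge0 ?(ltW w00) ?(ltW k00).
move=> tau K eta f tau0t K0 ceta Deta fK sum0 etaP.
have taup : 0 < tau by lra.
pose phi t j := kap j t * eta j t.
pose H t i := laplacian (w^~ t) (phi t) i.
pose F t := \sum_i kap i t * eta i t ^+ 2.
pose dF t := \sum_i (dkap i t * eta i t ^+ 2 + 2 * phi t i * (- tau * H t i + f i t)).
(* Up to the factor [w], [s ^ 2] is the dissipation rate of the energy. *)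
pose s t := Num.sqrt (\sum_a grad (phi t) a ^+ 2).
have s_ge0 t : 0 <= s t by exact: sqrtr_ge0.
have s2 t : s t ^+ 2 = \sum_a grad (phi t) a ^+ 2.
  by rewrite sqr_sqrtr // sumr_ge0 // => a _; exact: sqr_ge0.
have grads t a : `|grad (phi t) a| <= s t.
  rewrite -sqrtr_sqr ler_sqrt; last by rewrite sumr_ge0 // => b _; exact: sqr_ge0.
  by apply: (ler_sum_one (F := fun a => grad (phi t) a ^+ 2)) => b; exact: sqr_ge0.
have sub (t : R) : t \in `]0, 1[ -> t \in `[0, 1] by apply: subset_itv_oo_cc.
have phis (t : R) i : t \in `]0, 1[ -> `|phi t i| <= n * s t.
  move=> t01.
  (* As [eta] has sum 0, the potential takes both signs, so it is controlled by
     its differences. *)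
  have [j pj] : exists j, phi t i * phi t j <= 0.
    apply: contrapT => /forallNP nex.
    have : 0 < \sum_j eta j t * phi t i.
      apply: (@lt_le_trans _ _ (eta i t * phi t i)); last first.
        apply: (ler_sum_one (F := fun j => eta j t * phi t i)) => j.
        have /negP := nex j; rewrite -ltNge /phi => /ltW h.
        have [kj _] := kapb j t (sub _ t01).
        rewrite -(pmulr_rge0 (eta j t * phi t i) (lt_le_trans k00 kj)).
        by apply: le_trans h _; rewrite le_eqVlt; apply/orP; left; apply/eqP; rewrite /phi; ring.
      have /negP := nex i; rewrite -ltNge {1}/phi => h.
      have [kj _] := kapb i t (sub _ t01).
      by rewrite -(pmulr_rgt0 (eta i t * phi t i) (lt_le_trans k00 kj)) mulrA.
    by rewrite -mulr_suml sum0 // mul0r ltxx.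
  apply: (@le_trans _ _ `|phi t i - phi t j|); last exact: connected_potential_le.
  rewrite -ler_sqr ?nnegrE // !real_normK ?num_real //; nra.
have F0P : forall t : R, t \in `[0, 1] -> F t <= n ^+ 3 * (2 * n ^+ 2 * K / (tau * w0)) ^+ 2 / k0.
  apply: (@periodic_le _ F dF).
  - apply: within_continuous_sum => i; apply: within_continuousM.
      exact: derivable_within (Dkap i).
    by apply: within_continuousM; exact: ceta.
  - move=> t t01; apply: is_deriveSum => i.
    have D := is_deriveMul (Dkap i t) (is_deriveMul (Deta i t t01) (Deta i t t01)).
    apply: is_derive_eq; rewrite /phi /H /phi expr2; ring.
  - by apply: eq_bigr => i _; rewrite kapP etaP.
  move=> t t01 Ft.
  pose s0 := 2 * n ^+ 2 * K / (tau * w0).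
  have s00 : 0 <= s0.
    by rewrite /s0 divr_ge0 ?mulr_ge0 ?exprn_ge0 ?(ltW w00) ?(ltW taup).
  have sst : s0 < s t.
    rewrite -ltr_sqr ?nnegrE //.
    have : n ^+ 3 * s0 ^+ 2 / k0 < n * ((n * s t) ^+ 2 / k0).
      apply: (lt_le_trans Ft); apply: sum_le_card => i.
      have [kj _] := kapb i t (sub _ t01).
      rewrite ler_pdivlMr // (le_trans (_ : _ <= phi t i ^+ 2)) //.
        rewrite /phi exprMn expr2 mulrAC ler_wpM2r ?sqr_ge0 // ler_wpM2l //.
        exact: le_trans (ltW k00) kj.
      by rewrite -real_normK ?num_real // ler_sqr ?nnegrE ?mulr_ge0 // phis.
    have -> : n * ((n * s t) ^+ 2 / k0) = n ^+ 3 / k0 * s t ^+ 2 by ring.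
    rewrite mulrAC ltr_pM2l //.
    by rewrite divr_gt0 // exprn_gt0 //; lra.
  have spos : 0 < s t by lra.
  have -> : dF t = \sum_i dkap i t * eta i t ^+ 2 - 2 * tau * (\sum_i phi t i * H t i)
      + 2 * (\sum_i phi t i * f i t).
    rewrite !mulr_sumr -sumrB -big_split /=; apply: eq_bigr => i _; ring.
  have b1 : \sum_i dkap i t * eta i t ^+ 2 <= n * (K1 * (n * s t / k0) ^+ 2).
    apply: sum_le_card => i; have [kj dk] := kapb i t (sub _ t01).
    apply: (@le_trans _ _ (K1 * eta i t ^+ 2)).
      by rewrite ler_wpM2r ?sqr_ge0 // (le_trans _ dk) ?ler_norm.
    rewrite ler_wpM2l // -real_normK ?num_real // ler_sqr ?nnegrE //; last first.
      by rewrite divr_ge0 ?mulr_ge0 // ltW.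
    rewrite ler_pdivlMr // (le_trans _ (phis t i t01)) // /phi normrM mulrC.
    by rewrite ler_wpM2r // (le_trans kj) // ler_norm.
  have b2 : w0 * s t ^+ 2 <= \sum_i phi t i * H t i.
    rewrite flux_grad s2 mulr_sumr; apply: ler_sum => a _.
    have -> : grad (phi t) a * (w a t * grad (phi t) a) = w a t * grad (phi t) a ^+ 2 by ring.
    by rewrite ler_wpM2r ?sqr_ge0 // wb // sub.
  have b3 : \sum_i phi t i * f i t <= n * (n * s t * K).
    apply: sum_le_card => i; apply: (le_trans (ler_norm _)).
    by rewrite normrM ler_pM // ?phis ?fK.
  have c1 : n * (K1 * (n * s t / k0) ^+ 2) < tau * w0 * s t ^+ 2.
    have -> : n * (K1 * (n * s t / k0) ^+ 2) = (n ^+ 3 * K1 / k0 ^+ 2) * s t ^+ 2.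
      by field; rewrite gt_eqF.
    rewrite ltr_pM2r ?exprn_gt0 // -ltr_pdivrMr //.
    apply: (lt_le_trans _ tau0t).
    rewrite (_ : _ / w0 = n ^+ 3 * K1 / (k0 ^+ 2 * w0)) ?ltrDl //.
    by field; rewrite !gt_eqF.
  have c2 : n * (n * s t * K) * 2 < tau * w0 * s t ^+ 2.
    move: sst; rewrite /s0 ltr_pdivrMr ?mulr_gt0 // => h.
    have -> : n * (n * s t * K) * 2 = (2 * n ^+ 2 * K) * s t by ring.
    have -> : tau * w0 * s t ^+ 2 = (s t * (tau * w0)) * s t by ring.
    by rewrite ltr_pM2r.
  have : tau * (w0 * s t ^+ 2) <= tau * \sum_i phi t i * H t i by rewrite ler_pM2l.
  move: b1 b3 c1 c2; move: (\sum_i phi t i * H t i) (\sum_i phi t i * f i t) => X Y.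
  lra.
move=> i t t01; have [kj _] := kapb i t t01.
have h1 : k0 * eta i t ^+ 2 <= n ^+ 3 * (2 * n ^+ 2 * K / (tau * w0)) ^+ 2 / k0.
  apply: le_trans (F0P t t01); apply: le_trans (ler_sum_one (F := fun i => kap i t * eta i t ^+ 2) i _).
    by rewrite ler_wpM2r ?sqr_ge0.
  move=> j; have [kj' _] := kapb j t t01.
  by rewrite mulr_ge0 ?sqr_ge0 // (le_trans (ltW k00)).
have C0 : 0 <= 2 * n ^+ 4 / (w0 * k0) * K / tau.
  rewrite divr_ge0 ?(ltW taup) // mulr_ge0 //.
  by rewrite divr_ge0 ?mulr_ge0 ?exprn_ge0 ?(ltW w00) ?(ltW k00).
rewrite -ler_sqr ?nnegrE // real_normK ?num_real //.
have -> : 2 * n ^+ 4 / (w0 * k0) * K / tau = n ^+ 2 * (2 * n ^+ 2 * K / (tau * w0)) / k0.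
  by field; rewrite !gt_eqF.
rewrite -(ler_pM2l k00); apply: (le_trans h1).
move: (2 * _ * K / _) => y.
have -> : k0 * (n ^+ 2 * y / k0) ^+ 2 = n * (n ^+ 3 * y ^+ 2 / k0) by field; rewrite gt_eqF.
apply: ler_peMl => //; apply: divr_ge0; last exact: ltW.
by apply: mulr_ge0; [exact: exprn_ge0|exact: sqr_ge0].
Qed.

(** * The Boltzmann distribution and the adiabatic limit *)

Section Boltzmann.
Variables (R : realType) (n : nat).
Implicit Types (E dE ddE : 'I_n -> R -> R) (beta t : R).

Definition boltz beta E i t : R :=
  expR (- beta * E i t) / \sum_j expR (- beta * E j t).

(** The time derivative of [boltz] when [dE] is that of [E]. *)
Definition dboltz beta E dE i t : R :=
  beta * boltz beta E i t * \sum_j boltz beta E j t * (dE j t - dE i t).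

Lemma partition_gt0 beta E (i : 'I_n) t : 0 < \sum_j expR (- beta * E j t).
Proof.
apply: (lt_le_trans (expR_gt0 (- beta * E i t))).
by apply: (ler_sum_one (F := fun j => expR (- beta * E j t))) => j; exact: expR_ge0.
Qed.

Lemma boltz_gt0 beta E i t : 0 < boltz beta E i t.
Proof. by rewrite divr_gt0 ?expR_gt0 // (partition_gt0 _ _ i). Qed.

Lemma sum_boltz beta E t : (0 < n)%N -> \sum_i boltz beta E i t = 1.
Proof.
by move=> n0; rewrite -mulr_suml divff // gt_eqF // (partition_gt0 _ _ (Ordinal n0)).
Qed.

Lemma boltz_le1 beta E i t : boltz beta E i t <= 1.
Proof.
rewrite -(sum_boltz beta E t (leq_ltn_trans (leq0n i) (ltn_ord i))).
apply: (ler_sum_one (F := fun i => boltz beta E i t)) => j; exact/ltW/boltz_gt0.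
Qed.

Lemma boltz_le beta E i j t :
  boltz beta E i t <= expR (- (beta * (E i t - E j t))).
Proof.
rewrite /boltz ler_pdivrMr ?(partition_gt0 _ _ i) //.
apply: (@le_trans _ _ (expR (- (beta * (E i t - E j t))) * expR (- beta * E j t))).
  by rewrite -expRD le_eqVlt; apply/orP; left; apply/eqP; congr expR; ring.
rewrite ler_wpM2l ?expR_ge0 //.
by apply: (ler_sum_one (F := fun j => expR (- beta * E j t))) => k; exact: expR_ge0.
Qed.

Lemma is_derive_boltz beta E dE (t : R) :
  (forall i, is_derive t 1 (E i) (dE i t)) ->
  forall i, is_derive t 1 (boltz beta E i) (dboltz beta E dE i t).
Proof.
move=> DE i.
have De j := is_derive_expM (- beta) (DE j).
have Z0 : \sum_j expR (- beta * E j t) != 0 by rewrite gt_eqF // (partition_gt0 _ _ i).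
have := is_deriveMul (De i) (is_deriveInv Z0 (is_deriveSum De)) => D.
apply: is_derive_eq.
have -> : \sum_j - beta * dE j t * expR (- beta * E j t) =
   - beta * \sum_j dE j t * expR (- beta * E j t).
  by rewrite mulr_sumr; apply: eq_bigr => j _; ring.
have n0 : (0 < n)%N by exact: leq_ltn_trans (leq0n i) (ltn_ord i).
have -> : dboltz beta E dE i t =
    beta * boltz beta E i t * (\sum_j boltz beta E j t * dE j t - dE i t).
  rewrite /dboltz -[X in _ - X]mul1r -(sum_boltz beta E t n0) mulr_suml -sumrB.
  by congr (_ * _); apply: eq_bigr => j _; rewrite mulrBr.
have -> : \sum_j boltz beta E j t * dE j t =
  (\sum_j dE j t * expR (- beta * E j t)) / (\sum_j expR (- beta * E j t)).
  by rewrite mulr_suml; apply: eq_bigr => j _; rewrite /boltz; ring.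
rewrite /boltz.
by field.
Qed.

Lemma sum_dboltz beta E dE t : \sum_i dboltz beta E dE i t = 0.
Proof.
rewrite /dboltz; under eq_bigr do rewrite mulr_sumr.
pose T i j := beta * boltz beta E i t * boltz beta E j t * dE j t.
have -> : \sum_i \sum_j beta * boltz beta E i t * (boltz beta E j t * (dE j t - dE i t))
  = \sum_i \sum_j T i j - \sum_i \sum_j T j i.
  rewrite -sumrB; apply: eq_bigr => i _; rewrite -sumrB; apply: eq_bigr => j _.
  by rewrite /T; ring.
by rewrite [X in _ - X]exchange_big subrr.
Qed.

(** The time derivative of [dboltz] when [ddE] is that of [dE]. *)
Definition ddboltz beta E dE ddE i t : R :=
  beta * dboltz beta E dE i t * (\sum_j boltz beta E j t * (dE j t - dE i t)) +
  beta * boltz beta E i t * \sum_j (dboltz beta E dE j t * (dE j t - dE i t)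
     + boltz beta E j t * (ddE j t - ddE i t)).

Lemma is_derive_dboltz beta E dE ddE (t : R) :
  (forall i, is_derive t 1 (E i) (dE i t)) ->
  (forall i, is_derive t 1 (dE i) (ddE i t)) ->
  forall i, is_derive t 1 (dboltz beta E dE i) (ddboltz beta E dE ddE i t).
Proof.
move=> DE DdE i; have Db := is_derive_boltz beta DE.
have D1 : is_derive t 1 (fun x => beta * boltz beta E i x) (beta * dboltz beta E dE i t).
  by have := is_deriveMul (is_derive_cst beta t 1) (Db i); rewrite mul0r add0r.
apply: (is_deriveMul D1); apply: is_deriveSum => j.
exact: is_deriveMul.
Qed.

End Boltzmann.

Section Laplacian.
Variables (R : realType) (G : graph).

Lemma sum_flux (J : 'I_(ne G) -> R) : \sum_i flux J i = 0.
Proof.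
under eq_bigr do rewrite -[flux _ _]mul1r.
by rewrite (flux_grad (fun=> 1)) big1 // => a _; rewrite /grad subrr mul0r.
Qed.

Lemma laplacianD (w : 'I_(ne G) -> R) (p q : 'I_(nv G) -> R) i :
  laplacian w (fun j => p j + q j) i = laplacian w p i + laplacian w q i.
Proof.
rewrite /laplacian /flux -big_split; apply: eq_bigr => a _ /=.
by rewrite /grad; ring.
Qed.

Lemma laplacian_cst (w : 'I_(ne G) -> R) (c : R) i : laplacian w (fun=> c) i = 0.
Proof. by rewrite /laplacian /flux big1 // => a _; rewrite /grad subrr !mulr0. Qed.

Lemma incidence_le1 (i j k : 'I_(nv G)) : `|(i == j)%:R - (i == k)%:R| <= 1 :> R.
Proof.
by case: eqP; case: eqP; rewrite ?subrr ?subr0 ?sub0r ?normrN ?normr0 ?normr1.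
Qed.

End Laplacian.

Section Adiabatic.
Variables (R : realType) (G : graph).
Variables (E dE ddE : 'I_(nv G) -> R -> R) (W dW : 'I_(ne G) -> R -> R) (beta : R).
Hypothesis con : connected_graph G.
Hypothesis DE : forall i (t : R), is_derive t 1 (E i) (dE i t).
Hypothesis DdE : forall i (t : R), is_derive t 1 (dE i) (ddE i t).
Hypothesis cddE : forall i, {within `[0, 1], continuous (ddE i)}.
Hypothesis DW : forall a (t : R), is_derive t 1 (W a) (dW a t).
Hypothesis cdW : forall a, {within `[0, 1], continuous (dW a)}.
Hypotheses (EP : forall i, E i 0 = E i 1) (dEP : forall i, dE i 0 = dE i 1).
Hypothesis WP : forall a, W a 0 = W a 1.

Definition conductance a t := expR (- beta * W a t).
(** The potential of [rho] is constant exactly at multiples of the Boltzmann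
    distribution, where no current flows. *)
Definition potential (rho : 'I_(nv G) -> R -> R) t i := expR (beta * E i t) * rho i t.
Definition drift rho t i := laplacian (conductance^~ t) (potential rho t) i.

Lemma within_bounds : exists B, [/\ 0 < B,
  forall i (t : R), t \in `[0, 1] ->
    B^-1 <= expR (beta * E i t) <= B /\
    `|beta * dE i t * expR (beta * E i t)| <= B &
  forall a (t : R), t \in `[0, 1] ->
    B^-1 <= conductance a t <= B /\ `|- beta * dW a t * conductance a t| <= B].
Proof.
have cE i : {within `[0, 1], continuous (E i)} := derivable_within (DE i).
have cdE i : {within `[0, 1], continuous (dE i)} := derivable_within (DdE i).
have cW i : {within `[0, 1], continuous (W i)} := derivable_within (DW i).
have [M1 M10 H1] := within_bounded_family cE.
have [M2 M20 H2] := within_bounded_family cW.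
have [M3 M30 H3] := within_bounded_family cdE.
have [M4 M40 H4] := within_bounded_family cdW.
pose M := `|beta| * (M1 + M2).
pose B := expR M + `|beta| * (M3 + M4) * expR M.
have MB : expR M <= B by rewrite lerDl !mulr_ge0 ?addr_ge0 // expR_ge0.
have gen c x : `|c| = `|beta| -> `|x| <= M1 + M2 -> B^-1 <= expR (c * x) <= expR M.
  move=> cb xM; have : `|c * x| <= M by rewrite normrM cb ler_wpM2l.
  rewrite ler_norml => /andP[l r]; rewrite ler_expR r andbT.
  apply: (@le_trans _ _ (expR (- M))); last by rewrite ler_expR.
  by rewrite expRN lef_pV2 // posrE ?expR_gt0 // (lt_le_trans (expR_gt0 M)).
have gen2 c x y : `|c| = `|beta| -> `|x| <= M3 + M4 -> 0 < y <= expR M ->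
    `|c * x * y| <= B.
  move=> cb xM /andP[y0 yM]; rewrite !normrM cb (gtr0_norm y0).
  apply: (@le_trans _ _ (`|beta| * (M3 + M4) * expR M)); last by rewrite lerDr expR_ge0.
  by rewrite ler_pM ?mulr_ge0 // ?ler_wpM2l // ltW.
exists B; split; first exact: lt_le_trans (expR_gt0 M) MB.
- move=> i t t01; have /andP[g1 g2] : B^-1 <= expR (beta * E i t) <= expR M.
    by apply: gen => //; rewrite (le_trans (H1 _ _ t01)) // lerDl.
  rewrite g1 (le_trans g2) //; split => //; apply: gen2 => //; last by rewrite expR_gt0.
  by rewrite (le_trans (H3 _ _ t01)) // lerDl.
- move=> i t t01; rewrite /conductance.
  have /andP[g1 g2] : B^-1 <= expR (- beta * W i t) <= expR M.
    by apply: gen; rewrite ?normrN // (le_trans (H2 _ _ t01)) // lerDr.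
  rewrite g1 (le_trans g2) //; split => //; apply: gen2; rewrite ?normrN ?expR_gt0 //.
  by rewrite (le_trans (H4 _ _ t01)) // lerDr.
Qed.

(** The Boltzmann distribution is stationary for frozen parameters. *)
Lemma drift_boltz rho t i :
  drift rho t i = drift (fun i t => rho i t - boltz beta E i t) t i.
Proof.
rewrite /drift.
rewrite -[RHS]addr0 -(laplacian_cst (conductance^~ t) (\sum_j expR (- beta * E j t))^-1 i).
rewrite -laplacianD; congr laplacian; apply/funext => j.
rewrite /potential /boltz mulrBr mulrA -expRD.
have -> : beta * E j t + - beta * E j t = 0 by ring.
by rewrite expR0 mul1r subrK.
Qed.

(** The deviation [eta] of [rho] from the Boltzmann distribution solves the
    master equation with a bounded forcing term, so it is [O (1 / tau)].  Its
    derivative [zeta] solves the master equation as well; the forcing term now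
    contains [tau] times the derivative of the master operator applied to [eta],
    which is bounded by the first estimate.  Hence [zeta] is [O (1 / tau)]
    too. *)
Lemma adiabatic : exists C tau0 : R, 0 <= C /\ 0 < tau0 /\
  forall tau (rho : 'I_(nv G) -> R -> R), tau0 <= tau ->
   (forall i, {within `[0, 1], continuous (rho i)}) ->
   (forall i (t : R), t \in `]0, 1[ -> is_derive t 1 (rho i) (- tau * drift rho t i)) ->
   (forall t : R, t \in `[0, 1] -> \sum_i rho i t = 1) ->
   (forall i, rho i 0 = rho i 1) ->
   forall i (t : R), t \in `[0, 1] ->
     `|rho i t - boltz beta E i t| <= C / tau /\
     `|- tau * drift rho t i - dboltz beta E dE i t| <= C / tau.
Proof.
have [B [B0 BE BW]] := within_bounds.
have Dkap i (t : R) := is_derive_expM beta (DE i t).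
have Dw a (t : R) := is_derive_expM (- beta) (DW a t).
have Db i (t : R) := is_derive_boltz beta (DE^~ t) i.
have Ddb i (t : R) := is_derive_dboltz beta (DE^~ t) (DdE^~ t) i.
have kapP i : expR (beta * E i 0) = expR (beta * E i 1) by rewrite EP.
have Bi0 : 0 < B^-1 by rewrite invr_gt0.
have kapb i (t : R) : t \in `[0, 1] -> B^-1 <= expR (beta * E i t) /\
    `|beta * dE i t * expR (beta * E i t)| <= B.
  by move=> t01; have [/andP[h _] h2] := BE i t t01.
have wb a (t : R) : t \in `[0, 1] -> B^-1 <= conductance a t.
  by move=> t01; have [/andP[h _] _] := BW a t t01.
have [C1 [tau0 [C10 tau00 relax]]] :=
  periodic_relaxation con Bi0 Bi0 (ltW B0) Dkap kapb wb kapP.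
have cb i : {within `[0, 1], continuous (boltz beta E i)} := derivable_within (Db i).
have cdb i : {within `[0, 1], continuous (dboltz beta E dE i)} := derivable_within (Ddb i).
have cE i : {within `[0, 1], continuous (E i)} := derivable_within (DE i).
have cdE i : {within `[0, 1], continuous (dE i)} := derivable_within (DdE i).
have cW i : {within `[0, 1], continuous (W i)} := derivable_within (DW i).
have cc (c : R) : {within `[0, 1], continuous (fun _ : R => c)}.
  by move=> x; exact: cst_continuous.
have cddb i : {within `[0, 1], continuous (ddboltz beta E dE ddE i)}.
  apply: within_continuousD; apply: within_continuousM.
  - by apply: within_continuousM.
  - apply: within_continuous_sum => j; apply: within_continuousM => //.
    by apply: within_continuousD => //; exact: within_continuousN.
  - by apply: within_continuousM.
  - apply: within_continuous_sum => j; apply: within_continuousD.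
    apply: within_continuousM => //.
    by apply: within_continuousD => //; exact: within_continuousN.
  - apply: within_continuousM => //.
    by apply: within_continuousD => //; exact: within_continuousN.
have [K1 K10 dbK] := within_bounded_family cdb.
have [K2 K20 ddbK] := within_bounded_family cddb.
pose m : R := (ne G)%:R.
pose K3 := 4 * m * B ^+ 2 * C1 * K1 + K2.
have m0 : 0 <= m by exact: ler0n.
have K30 : 0 <= K3 by rewrite addr_ge0 ?mulr_ge0 // ?exprn_ge0 // ltW.
exists (C1 * K1 + C1 * K3), tau0; split; first by rewrite addr_ge0 // mulr_ge0.
split=> // tau rho tau0t crho Drho rho1 rhoP.
have taup : 0 < tau := lt_le_trans tau00 tau0t.
have n0 : (0 < nv G)%N by case: con.
have sub (t : R) : t \in `]0, 1[ -> t \in `[0, 1] by apply: subset_itv_oo_cc.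
pose eta i t := rho i t - boltz beta E i t.
have ceta i : {within `[0, 1], continuous (eta i)}.
  by apply: within_continuousD => //; exact: within_continuousN.
have bP i : boltz beta E i 0 = boltz beta E i 1.
  by rewrite /boltz EP; under eq_bigr do rewrite EP.
have dbP i : dboltz beta E dE i 0 = dboltz beta E dE i 1.
  rewrite /dboltz bP; congr (_ * _); apply: eq_bigr => j _.
  by rewrite bP !dEP.
have etaP i : eta i 0 = eta i 1 by rewrite /eta bP rhoP.
have Deta i (t : R) : t \in `]0, 1[ -> is_derive t 1 (eta i)
    (- tau * drift eta t i + - dboltz beta E dE i t).
  move=> t01; have Dr := Drho i t t01; rewrite drift_boltz in Dr.
  by have := is_deriveB Dr (Db i t).
have eta_le i (t : R) : t \in `[0, 1] -> `|eta i t| <= C1 * K1 / tau.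
  apply: relax tau0t K10 ceta Deta _ _ etaP i t.
    by move=> i t t01; rewrite normrN dbK // sub.
  by move=> t t01; rewrite sumrB sum_boltz // rho1 ?subrr // sub.
pose zeta i t := - tau * drift eta t i - dboltz beta E dE i t.
(* [dpot] collects the terms in the derivative of the potential of [eta] that
   come from the derivative of [E]. *)
pose dpot t j := beta * dE j t * expR (beta * E j t) * eta j t.
pose f i t := - tau * (\sum_a ((i == d0 a)%:R - (i == d1 a)%:R) *
   (- beta * dW a t * conductance a t * grad (potential eta t) a
     + conductance a t * grad (dpot t) a)) - ddboltz beta E dE ddE i t.
have czeta i : {within `[0, 1], continuous (zeta i)}.
  apply: within_continuousD; last exact: within_continuousN.
  apply: within_continuousM => //; apply: within_continuous_sum => a.
  apply: within_continuousM => //; apply: within_continuousM.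
    exact: derivable_within (Dw a).
  by apply: within_continuousD; [|apply: within_continuousN];
    apply: within_continuousM => //; exact: derivable_within (Dkap _).
have Dzeta i (t : R) : t \in `]0, 1[ -> is_derive t 1 (zeta i)
    (- tau * drift zeta t i + f i t).
  move=> t01.
  have Dpot j : is_derive t 1 (fun t => potential eta t j)
      (dpot t j + potential zeta t j) by exact: is_deriveMul (Dkap j t) (Deta j t t01).
  have Dgr a : is_derive t 1 (fun t => grad (potential eta t) a)
     (grad (dpot t) a + grad (potential zeta t) a).
    have := is_deriveB (Dpot (d0 a)) (Dpot (d1 a)) => D.
    by apply: is_derive_eq; rewrite /grad; ring.
  have D1 : is_derive t 1 (fun t => drift eta t i)
     (\sum_a ((i == d0 a)%:R - (i == d1 a)%:R) *
       ((- beta * dW a t * conductance a t) * grad (potential eta t) a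
       + conductance a t * (grad (dpot t) a + grad (potential zeta t) a))).
    have D0 a : is_derive t 1 (fun x => ((i == d0 a)%:R - (i == d1 a)%:R) *
        (conductance a x * grad (potential eta x) a))
      (((i == d0 a)%:R - (i == d1 a)%:R) *
       ((- beta * dW a t * conductance a t) * grad (potential eta t) a
       + conductance a t * (grad (dpot t) a + grad (potential zeta t) a))).
      have := is_deriveMul (is_derive_cst ((i == d0 a)%:R - (i == d1 a)%:R : R) t 1)
        (is_deriveMul (Dw a t) (Dgr a)).
      by rewrite mul0r add0r.
    exact: (is_deriveSum D0).
  have D2 := is_deriveB (is_deriveMul (is_derive_cst (- tau) t 1) D1) (Ddb i t).
  apply: is_derive_eq.
  rewrite mul0r add0r /f addrA; congr (_ - _).
  rewrite -mulrDr; congr (_ * _); rewrite -big_split; apply: eq_bigr => a _ /=.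
  by ring.
have fK i (t : R) : t \in `]0, 1[ -> `|f i t| <= K3.
  move=> /sub t01; apply: (le_trans (ler_normB _ _)); rewrite lerD ?ddbK //.
  rewrite normrM normrN (gtr0_norm taup).
  have -> : 4 * m * B ^+ 2 * C1 * K1 = tau * (m * (4 * B ^+ 2 * (C1 * K1 / tau))).
    by field; rewrite gt_eqF.
  Show.   rewrite ler_pM2l //; apply: (le_trans (ler_norm_sum _ _ _)).
  apply: sum_le_card => a; rewrite normrM.
  set h := C1 * K1 / tau.
  have h0 : 0 <= h by rewrite divr_ge0 ?mulr_ge0 // ltW.
  have key (x : 'I_(nv G) -> R) : (forall j, `|x j| <= B) -> 
      `|grad (fun j => x j * eta j t) a| <= 2 * B * h.
    move=> xB; apply: (le_trans (ler_normB _ _)).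
    rewrite (_ : 2 * B * h = B * h + B * h); last by ring.
    by apply: lerD; rewrite normrM ler_pM // eta_le.
  have g1 : `|grad (potential eta t) a| <= 2 * B * h.
    apply: key => j; have [/andP[l u] _] := BE j t t01.
    by rewrite gtr0_norm // expR_gt0.
  have g2 : `|grad (dpot t) a| <= 2 * B * h.
    by apply: key => j; have [] := BE j t t01.
  have [/andP[l u] u'] := BW a t t01.
  rewrite -[leRHS]mul1r ler_pM ?incidence_le1 //.
  rewrite (le_trans (ler_normD _ _)) // !normrM.
  have -> : 4 * B ^+ 2 * h = B * (2 * B * h) + B * (2 * B * h) by ring.
  apply: lerD; last first.
    by rewrite ler_pM // gtr0_norm // expR_gt0.
  by rewrite ler_pM // -!normrM.
have zsum (t : R) : t \in `]0, 1[ -> \sum_i zeta i t = 0.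
  move=> _; rewrite sumrB sum_dboltz subr0 -mulr_sumr.
  by rewrite /drift /laplacian sum_flux mulr0.
have zetaP i : zeta i 0 = zeta i 1.
  rewrite /zeta dbP; congr (_ * _ - _); apply: eq_bigr => a _.
  by rewrite /grad /potential /conductance !etaP !EP WP.
have zeta_le := relax tau K3 zeta f tau0t K30 czeta Dzeta fK zsum zetaP.
move=> i t t01; rewrite drift_boltz; split.
  apply: (le_trans (eta_le i t t01)).
  by rewrite ler_pM2r ?invr_gt0 // lerDl mulr_ge0.
apply: (le_trans (zeta_le i t t01)).
by rewrite ler_pM2r ?invr_gt0 // lerDr mulr_ge0.
Qed.

End Adiabatic.

(** * Generic translations of a loop *)

Lemma ord_dist_ge1 (R : realType) k (i j : 'I_k) : i != j -> 1 <= `|i%:R - j%:R| :> R.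
Proof.
move=> ij; have : (i < j)%N || (j < i)%N by rewrite -neq_ltn.
case/orP => lt; first rewrite distrC.
all: by rewrite ger0_norm ?subr_ge0 ?ler_nat 1?ltnW // lerBrDr nat1r ler_nat.
Qed.

(** A pigeonhole argument on a [K * K] grid of mesh [h].  Cut [[0, 1]]
    into pieces of length [1 / N], with [N = c * K], on which each of the curves
    moves by at most [h / 4].  On one piece a curve is then within [h / 4] of at most one
    grid point, so the curves approach at most [#|P| * (N + 1)] grid points, a
    number that grows linearly with [K]. *)
Lemma lipschitz_curves_avoid_grid (R : realType) (P : finType) (x y : P -> R -> R) (L eta : R) :
  0 < eta -> 0 <= L ->
  (forall p (s t : R), s \in `[0, 1] -> t \in `[0, 1] ->
     `|x p s - x p t| <= L * `|s - t| /\ `|y p s - y p t| <= L * `|s - t|) ->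
  exists s r d : R, [/\ 0 <= s < eta, 0 <= r < eta, 0 < d &
    forall p (t : R), t \in `[0, 1] -> d <= `|x p t - s| \/ d <= `|y p t - r|].
Proof.
move=> eta0 L0 lip.
(* [K] is chosen so that [K * K] exceeds [#|P| * (c * K + 1)]. *)
pose c := (Num.truncn (4 * L / eta)).+1.
have cL : 4 * L / eta < c%:R by rewrite truncnS_gt.
pose K := (#|P| * c.+1).+1; pose N := (c * K)%N.
have K0 : 0 < K%:R :> R by rewrite ltr0n.
have N0 : 0 < N%:R :> R by rewrite ltr0n muln_gt0.
pose h := eta / K%:R.
have h0 : 0 < h by rewrite divr_gt0.
have LN : L / N%:R <= h / 4.
  rewrite /N natrM /h ler_pdivrMr ?mulr_gt0 ?ltr0n //.
  rewrite (_ : _ * (c%:R * K%:R) = c%:R * eta / 4); last by field; rewrite gt_eqF.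
  move: cL; rewrite ltr_pdivrMr // => cL; rewrite ler_pdivlMr //; lra.
apply: contrapT => noavoid.
have bad (kl : 'I_K * 'I_K) : exists pj : P * 'I_N.+1, exists t : R,
    [/\ t \in `[0, 1], pj.2%:R <= t * N%:R < pj.2%:R + 1,
      `|x pj.1 t - h * kl.1%:R| < h / 4 & `|y pj.1 t - h * kl.2%:R| < h / 4].
  apply: contrapT => nobad; apply: noavoid.
  have small (k : 'I_K) : 0 <= h * k%:R < eta.
    rewrite mulr_ge0 ?(ltW h0) //= /h mulrAC -mulrA gtr_pMr //.
    by rewrite ltr_pdivrMr // mul1r ltr_nat.
  exists (h * kl.1%:R), (h * kl.2%:R), (h / 4); split => //; first by rewrite divr_gt0.
  move=> p t t01; have [?|xs] := leP (h / 4) `|x p t - h * kl.1%:R|; first by left.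
  right; rewrite leNgt; apply/negP => ys; apply: nobad.
  have t0 : 0 <= t by rewrite (itvP t01).
  have /andP[j1 j2] := truncn_itv (mulr_ge0 t0 (ltW N0)).
  have jN : (Num.truncn (t * N%:R) < N.+1)%N.
    rewrite ltnS -(ler_nat R); apply: (le_trans j1).
    by rewrite ler_piMl ?(ltW N0) // (itvP t01).
  exists (p, Ordinal jN), t; split => //=.
  by rewrite j1 -natr1 in j2 *.
(* If all the grid points were approached, each would get its own pair of a
   curve and a piece. *)
have [f fP] := choice bad.
have finj : injective f.
  move=> kl kl' eqf; have [t [t01 /andP[tj tj'] tx ty]] := fP kl.
  have [t' [t01' /andP[sj sj'] sx sy]] := fP kl'.
  rewrite -eqf in sj sj' sx sy.
  have tt' : `|t - t'| <= N%:R^-1.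
    rewrite -(ler_pM2r N0) mulVf ?gt_eqF // -{1}(gtr0_norm N0) -normrM mulrBl ler_norml.
    by apply/andP; split; lra.
  have [lx ly] := lip (f kl).1 t t' t01 t01'.
  have Ltt : L * `|t - t'| <= h / 4 by apply: le_trans LN; rewrite ler_wpM2l.
  have close (u v : R) (k k' : 'I_K) : `|u - v| <= L * `|t - t'| ->
      `|u - h * k%:R| < h / 4 -> `|v - h * k'%:R| < h / 4 -> k = k'.
    move=> uv uk vk; have : `|h * k%:R - h * k'%:R| < h.
      move: uv uk vk; rewrite !ler_norml !ltr_norml => /andP[? ?] /andP[? ?] /andP[? ?].
      by apply/andP; split; lra.
    rewrite -mulrBr normrM gtr0_norm // gtr_pMr // => kk.
    by apply/eqP; apply: contraLR kk => /(ord_dist_ge1 R); rewrite -leNgt.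
  have e1 := close _ _ _ _ lx tx sx; have e2 := close _ _ _ _ ly ty sy.
  by rewrite [kl]surjective_pairing e1 e2 -surjective_pairing.
have := leq_card f finj; rewrite !card_prod !card_ord; apply/negP; rewrite -ltnNge.
rewrite /N; apply: (@leq_ltn_trans (#|P| * c.+1 * K)).
  by rewrite -mulnA leq_mul2l mulSn; apply/orP; right; rewrite addnC -addn1 leq_add2l.
by rewrite ltn_pmul2r.
Qed.

Definition gaps (R : realType) (n : nat) (d : R) (v : 'I_n -> R) : Prop :=
  forall i j, i != j -> d <= `|v i - v j|.

(** With vertices shifted by [s * i] and edges by [r * a], the coincidences of
    [E i] with [E j] and of [W a] with [W b] happen when [s] and [r] equal the
    difference quotients of [E] and [W].  So [(s, r)] has to stay away from
    finitely many Lipschitz curves.  Distinct indices are at distance at least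
    1, hence multiplying by their difference preserves the gap. *)
Lemma generic_shift (R : realType) (n m : nat) (E : 'I_n -> R -> R) (W : 'I_m -> R -> R)
    (L eta : R) : 0 < eta -> 0 <= L ->
  (forall i (s t : R), s \in `[0, 1] -> t \in `[0, 1] -> `|E i s - E i t| <= L * `|s - t|) ->
  (forall a (s t : R), s \in `[0, 1] -> t \in `[0, 1] -> `|W a s - W a t| <= L * `|s - t|) ->
  exists s r d : R, [/\ 0 <= s < eta, 0 <= r < eta, 0 < d &
    forall t : R, t \in `[0, 1] -> gaps d (fun i => E i t + s * i%:R) \/
                               gaps d (fun a => W a t + r * a%:R)].
Proof.
move=> eta0 L0 lE lW.
(* For equal indices the denominator vanishes and the slope is 0. *)
pose slope k (f : 'I_k -> R -> R) (p : 'I_k * 'I_k) t := (f p.2 t - f p.1 t) / (p.1%:R - p.2%:R).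
have slopeL k (f : 'I_k -> R -> R) p (s t : R) :
    (forall i, `|f i s - f i t| <= L * `|s - t|) ->
    `|slope k f p s - slope k f p t| <= 2 * L * `|s - t|.
  move=> lf; have B0 : 0 <= 2 * L * `|s - t| by rewrite !mulr_ge0.
  rewrite /slope -mulrBl normrM; have [->|ne] := eqVneq p.1 p.2.
    by rewrite !subrr normr0 mul0r.
  rewrite normfV ler_pdivrMr; last by rewrite (lt_le_trans ltr01) // ord_dist_ge1.
  apply: (@le_trans _ _ (2 * L * `|s - t|)); last by rewrite ler_peMr // ord_dist_ge1.
  rewrite (_ : _ - _ = (f p.2 s - f p.2 t) - (f p.1 s - f p.1 t)); last by ring.
  apply: (le_trans (ler_normB _ _)); rewrite -mulrA (mulr_natl _ 2) mulr2n.
  by rewrite lerD.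
have slope_gap k (f : 'I_k -> R -> R) (i j : 'I_k) s d t : i != j -> 0 < d ->
    d <= `|slope k f (i, j) t - s| -> d <= `|f i t + s * i%:R - (f j t + s * j%:R)|.
  move=> ij d0 h; have ij1 := ord_dist_ge1 R ij.
  have ij0 : i%:R - j%:R != 0 :> R by rewrite -normr_gt0 (lt_le_trans ltr01).
  rewrite (_ : _ - _ = (slope k f (i, j) t - s) * (j%:R - i%:R)); last first.
    by rewrite /slope /=; field.
  rewrite normrM [X in _ * X]distrC; apply: (le_trans h).
  by rewrite ler_peMr // ord_dist_ge1.
pose x (p : ('I_n * 'I_n) * ('I_m * 'I_m)) := slope n E p.1.
pose y (p : ('I_n * 'I_n) * ('I_m * 'I_m)) := slope m W p.2.
have [|p s t s01 t01|s [r [d [sb rb d0 H]]]] :=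
  @lipschitz_curves_avoid_grid R _ x y (2 * L) eta eta0.
- by rewrite mulr_ge0.
- by split; apply: slopeL => i; [exact: lE|exact: lW].
exists s, r, d; split => // t t01.
have [gE|/existsNP[i /existsNP[j /not_implyP[ij /negP]]]] :=
  pselect (gaps d (fun i => E i t + s * i%:R)); first by left.
rewrite -ltNge => small; right => a b ab.
have [h|] := H ((i, j), (a, b)) t t01; last exact: slope_gap.
by have := slope_gap _ _ _ _ _ _ _ ij d0 h; rewrite leNgt small.
Qed.

(** * Quantization at low temperature *)

Section Quantization.
Variables (R : realType) (G : graph).
Variables (E dE ddE : 'I_(nv G) -> R -> R) (W dW : 'I_(ne G) -> R -> R).
Hypothesis con : connected_graph G.
Hypothesis DE : forall i (t : R), is_derive t 1 (E i) (dE i t).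
Hypothesis DdE : forall i (t : R), is_derive t 1 (dE i) (ddE i t).
Hypothesis cddE : forall i, {within `[0, 1], continuous (ddE i)}.
Hypothesis DW : forall a (t : R), is_derive t 1 (W a) (dW a t).
Hypothesis cdW : forall a, {within `[0, 1], continuous (dW a)}.
Hypotheses (EP : forall i, E i 0 = E i 1) (dEP : forall i, dE i 0 = dE i 1).
Hypothesis WP : forall a, W a 0 = W a 1.
Variables (L d : R).
Hypotheses (L0 : 0 <= L) (d_gt0 : 0 < d).
Hypothesis dEL : forall i (t : R), t \in `[0, 1] -> `|dE i t| <= L.
Hypothesis EL : forall i (s t : R), s \in `[0, 1] -> t \in `[0, 1] ->
  `|E i s - E i t| <= L * `|s - t|.
Hypothesis WL : forall a (s t : R), s \in `[0, 1] -> t \in `[0, 1] ->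
  `|W a s - W a t| <= L * `|s - t|.
Hypothesis gapEW : forall t : R, t \in `[0, 1] -> gaps d (E^~ t) \/ gaps d (W^~ t).

Let n : R := (nv G)%:R.

Lemma dboltz_le beta i (t : R) : 0 <= beta -> t \in `[0, 1] ->
  `|dboltz beta E dE i t| <= 2 * L * n * beta.
Proof.
move=> b0 t01; rewrite /dboltz -mulrA normrM ger0_norm // [leRHS]mulrC.
rewrite ler_wpM2l // normrM (gtr0_norm (boltz_gt0 _ _ _ _)).
apply: (@le_trans _ _ (1 * `|\sum_j boltz beta E j t * (dE j t - dE i t)|)).
  by rewrite ler_wpM2r // boltz_le1.
rewrite mul1r mulrC; apply: (le_trans (ler_norm_sum _ _ _)).
apply: sum_le_card => j; rewrite normrM (gtr0_norm (boltz_gt0 _ _ _ _)).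
rewrite -[leRHS]mul1r ler_pM ?boltz_le1 ?(ltW (boltz_gt0 _ _ _ _)) //.
by rewrite (le_trans (ler_normB _ _)) // mulr_natl mulr2n lerD // dEL.
Qed.

(** Each term contains a product of two distinct Boltzmann weights, one of which
    is exponentially small. *)
Lemma dboltz_gap beta i (t c : R) : 0 <= beta -> t \in `[0, 1] -> gaps c (E^~ t) ->
  `|dboltz beta E dE i t| <= 2 * L * n * (beta * expR (- (beta * c))).
Proof.
move=> b0 t01 gE; rewrite /dboltz -mulrA normrM ger0_norm //.
rewrite [leRHS](_ : _ = beta * (n * (expR (- (beta * c)) * (2 * L)))); last by ring.
rewrite ler_wpM2l // mulr_sumr; apply: (le_trans (ler_norm_sum _ _ _)).
apply: sum_le_card => j; rewrite mulrA normrM.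
have [->|ij] := eqVneq i j; first by rewrite subrr normr0 mulr0 !mulr_ge0 ?expR_ge0.
apply: ler_pM => //; last first.
  by rewrite (le_trans (ler_normB _ _)) // mulr_natl mulr2n lerD // dEL.
rewrite gtr0_norm; last by apply: mulr_gt0; exact: boltz_gt0.
have mono k l : c <= E k t - E l t -> boltz beta E k t <= expR (- (beta * c)).
  move=> h; apply: le_trans (boltz_le _ _ _ l _) _.
  by rewrite ler_expR lerN2 ler_wpM2l.
have := gE _ _ ij; rewrite ler_normr => /orP[] h.
- rewrite -[leRHS]mulr1 ler_pM ?boltz_le1 ?(ltW (boltz_gt0 _ _ _ _)) //; exact: mono h.
- rewrite -[leRHS]mul1r ler_pM ?boltz_le1 ?(ltW (boltz_gt0 _ _ _ _)) //.
  by apply: (mono _ i); rewrite opprB in h.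
Qed.

(** The low temperature limit of [boltz] when the energies are distinct. *)
Definition ground t i : int := `[< forall j, E i t <= E j t >]%:R.

Lemma boltz_ground beta i (t c : R) : 0 <= beta -> 0 < c -> gaps c (E^~ t) ->
  `|boltz beta E i t - (ground t i)%:~R| <= n * expR (- (beta * c)).
Proof.
move=> b0 c0 gE.
have mono k l : k != l -> E l t <= E k t -> boltz beta E k t <= expR (- (beta * c)).
  move=> kl lk; apply: le_trans (boltz_le _ _ _ l _) _.
  rewrite ler_expR lerN2 ler_wpM2l //; apply: le_trans (gE _ _ kl) _.
  by rewrite ger0_norm // subr_ge0.
have n1 : 1 <= n by rewrite /n ler1n; case: con.
rewrite /ground; case: asboolP => [min|]; last first.
  move=> /existsNP[j /negP]; rewrite -ltNge => ji.
  rewrite subr0 (gtr0_norm (boltz_gt0 _ _ _ _)).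
  apply: (@le_trans _ _ (expR (- (beta * c)))); last by rewrite ler_peMl ?expR_ge0.
  by apply: (mono _ j); [apply: contraTneq ji => ->; rewrite ltxx|exact: ltW].
rewrite distrC ger0_norm ?subr_ge0 ?boltz_le1 //=.
rewrite -(sum_boltz beta E t con.1) (bigD1 i) //= addrAC subrr add0r big_mkcond.
apply: sum_le_card => j; case: eqVneq => [_|ji] /=; first exact: expR_ge0.
exact: (mono _ i).
Qed.

Lemma gaps_near k (f : 'I_k -> R -> R) (s t : R) :
  (forall i, `|f i s - f i t| <= d / 4) -> gaps d (f^~ s) -> gaps (d / 2) (f^~ t).
Proof.
move=> near gs i j ij; have := gs i j ij; have := near i; have := near j.
rewrite ler_normr !ler_norml ler_normr => /andP[? ?] /andP[? ?] /orP[?|?].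
- by apply/orP; left; lra.
- by apply/orP; right; lra.
Qed.

Lemma lt_near (f g : R -> R) (s t : R) : `|f s - f t| <= d / 4 -> `|g s - g t| <= d / 4 ->
  d <= `|f s - g s| -> f s < g s -> f t <= g t - d / 2.
Proof.
rewrite !ler_norml ler_normr => /andP[? ?] /andP[? ?] /orP[?|?] ?; lra.
Qed.

(** The integer [M a] is found as follows.  Cut [[0, 1]] at the points [T k],
    with pieces so short that gaps [d] at [T k] are still gaps [d / 2] on the
    piece that starts at [T k].  Let [c (T k) a] be the integral functional of
    [tree_functional] for the order of [W] at [T k], or 0 if the energies have
    gaps [d] at [T k].  On the piece, [P a + c (T k) a . rho] is almost
    constant.  Summation by parts turns the sum of the
    [- c (T k) a . (rho (T k.+1) - rho (T k))] into the sum of the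
    [- (c (T k) a - c (T k.+1) a) . rho (T k.+1)], where the boundary terms
    cancel because [c] and [rho] are periodic, and [rho (T k.+1)] can be replaced
    by the ground state unless [c (T k)] and [c (T k.+1)] agree. *)
Lemma quantization : exists M : 'I_(ne G) -> int, forall e : R, 0 < e ->
  exists b0, forall beta, b0 <= beta -> exists tau0, forall tau, tau0 <= tau ->
  forall (rho : 'I_(nv G) -> R -> R) (P : 'I_(ne G) -> R -> R),
   (forall i, {within `[0, 1], continuous (rho i)}) ->
   (forall i (t : R), t \in `]0, 1[ ->
      is_derive t 1 (rho i) (- tau * drift E W beta rho t i)) ->
   (forall t : R, t \in `[0, 1] -> \sum_i rho i t = 1) ->
   (forall i, rho i 0 = rho i 1) ->
   (forall a, {within `[0, 1], continuous (P a)}) ->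
   (forall a (t : R), t \in `]0, 1[ -> is_derive t 1 (P a)
      (tau * (conductance W beta a t * grad (potential E beta rho t) a))) ->
   forall a, `|P a 1 - P a 0 - (M a)%:~R| <= e.
Proof.
pose strict_total (o : rel 'I_(ne G)) := [/\ irreflexive o, transitive o &
  forall a b, a != b -> o a b || o b a].
have /choice[lC lCP] (o : rel 'I_(ne G)) :
    exists lC : ('I_(ne G) -> 'I_(nv G) -> int) * ('I_(ne G) -> R), strict_total o ->
    forall a, 0 <= lC.2 a /\
    forall (w : 'I_(ne G) -> R) phi (x : R), (forall b, 0 < w b) -> 0 <= x ->
      (forall a b, o b a -> w a <= x * w b) ->
      `|w a * grad phi a
        - \sum_i (lC.1 a i)%:~R * flux (fun b => w b * grad phi b) i|
      <= lC.2 a * x * \sum_i `|flux (fun b => w b * grad phi b) i|.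
  have [st|no] := pselect (strict_total o).
    by case: st => irr tr tot; have [l [C H]] := tree_functional R irr tr tot; exists (l, C).
  by exists (fun _ _ => 0, fun=> 0) => /no.
pose o t : rel 'I_(ne G) := fun a b => W a t < W b t.
pose c t a i : int := if `[< gaps d (E^~ t) >] then 0 else (lC (o t)).1 a i.
have oP (t : R) : gaps d (W^~ t) -> strict_total (o t).
  move=> gW; split=> [a|b a b'|a b ab]; first exact: ltxx.
    exact: lt_trans.
  rewrite /o; case: ltgtP => // eqW; have := gW a b ab.
  by rewrite eqW subrr normr0 leNgt d_gt0.
pose N := (Num.truncn (4 * L / d)).+1.
have N0 : 0 < N%:R :> R by rewrite ltr0n.
have LN : L / N%:R <= d / 4.
  have : 4 * L / d < N%:R by rewrite truncnS_gt.
  rewrite ltr_pdivrMr // => h; rewrite ler_pdivrMr //; lra.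
pose T k : R := k%:R / N%:R.
have hd : d / 2 <= d by rewrite ler_pdivrMr // ler_peMr ?ler1n // ltW.
have T0 : T 0 = 0 by rewrite /T mul0r.
have TN : T N = 1 by rewrite /T divff // gt_eqF.
have T01 k : (k <= N)%N -> T k \in `[0, 1].
  by move=> kN; rewrite in_itv /= divr_ge0 //= /T ler_pdivrMr // mul1r ler_nat.
have TS k : T k.+1 = T k + N%:R^-1 by rewrite /T -natr1 mulrDl mul1r.
have Tlt k : T k < T k.+1 by rewrite TS ltrDl invr_gt0.
have Tsub k (t : R) : (k < N)%N -> t \in `[T k, T k.+1] -> t \in `[0, 1].
  move=> kN; have := T01 _ kN; have := T01 _ (ltnW kN).
  rewrite !in_itv /= => /andP[? ?] /andP[? ?] /andP[? ?]; apply/andP; split; lra.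
have Tsuboo k (t : R) : (k < N)%N -> t \in `]T k, T k.+1[ -> t \in `]0, 1[.
  move=> kN; have := T01 _ kN; have := T01 _ (ltnW kN).
  rewrite !in_itv /= => /andP[? ?] /andP[? ?] /andP[? ?]; apply/andP; split; lra.
have close k (t : R) : (k < N)%N -> t \in `[T k, T k.+1] -> L * `|T k - t| <= d / 4.
  move=> kN; rewrite in_itv /= TS => /andP[? ?]; apply: le_trans LN.
  by rewrite ler_wpM2l // ler_norml; apply/andP; split; lra.
have closeE k (t : R) i : (k < N)%N -> t \in `[T k, T k.+1] -> `|E i (T k) - E i t| <= d / 4.
  move=> kN tk; apply: le_trans (close k t kN tk).
  by apply: EL; [exact: T01 (ltnW kN)|exact: Tsub tk].
have closeW k (t : R) a : (k < N)%N -> t \in `[T k, T k.+1] -> `|W a (T k) - W a t| <= d / 4.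
  move=> kN tk; apply: le_trans (close k t kN tk).
  by apply: WL; [exact: T01 (ltnW kN)|exact: Tsub tk].
have right_end k : T k.+1 \in `[T k, T k.+1] by rewrite in_itv /= lexx ltW.
(* Where the energies do not have gaps [d / 2] at [T k.+1], the barriers have
   gaps [d] at both ends of the piece, and their order does not change. *)
have node k : (k < N)%N -> gaps (d / 2) (E^~ (T k.+1)) \/ c (T k) = c (T k.+1).
  move=> kN; have [gE|gE] := pselect (gaps (d / 2) (E^~ (T k.+1))); first by left.
  right; have nE : ~ gaps d (E^~ (T k)).
    by move=> gEk; apply: gE; apply: gaps_near gEk => i; exact: closeE.
  have nE' : ~ gaps d (E^~ (T k.+1)).
    by move=> gEk; apply: gE => i j /gEk; exact: (le_trans hd).
  have [//|gW] := gapEW (T01 _ (ltnW kN)); have [//|gW'] := gapEW (T01 _ kN).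
  rewrite /c asboolF // asboolF //; congr ((lC _).1).
  apply/funext => a; apply/funext => b; rewrite /o.
  have [->|ab] := eqVneq a b; first by rewrite !ltxx.
  have ba : b != a by rewrite eq_sym.
  have h1 := lt_near (closeW k _ a kN (right_end k)) (closeW k _ b kN (right_end k)) (gW _ _ ab).
  have h2 := lt_near (closeW k _ b kN (right_end k)) (closeW k _ a kN (right_end k)) (gW _ _ ba).
  have := oP _ gW => -[_ _ /(_ _ _ ab)]; rewrite /o => /orP[] lt.
    by rewrite lt; apply/esym; apply: le_lt_trans (h1 lt) _; rewrite gtrBl divr_gt0.
  rewrite [LHS]lt_gtF // [RHS]lt_gtF //; apply: le_lt_trans (h2 lt) _.
  by rewrite gtrBl divr_gt0.
pose M a : int := - \sum_(k < N) \sum_i (c (T k) a i - c (T k.+1) a i) * ground (T k.+1) i.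
pose Cmax := \sum_(k < N) \sum_a `|(lC (o (T k))).2 a|.
have Cmax0 : 0 <= Cmax by do 2 (apply: sumr_ge0 => ? _).
have Cle (k : 'I_N) a : (lC (o (T k))).2 a <= Cmax.
  apply: (le_trans (ler_norm _)).
  apply: (le_trans (ler_sum_one (F := fun a => `|(lC (o (T k))).2 a|) a _)) => //.
  by apply: (ler_sum_one (F := fun k : 'I_N => \sum_a `|(lC (o (T k))).2 a|)) => j; apply: sumr_ge0.
have n0 : 0 <= n by exact: ler0n.
(* [D1 * e1] bounds the error on a piece and [D2 * e1] the error made by
   replacing [rho] by the ground state at all the nodes. *)
pose D1 := (Cmax + 1) * (n * (2 * L * n + 1)).
pose D2 := \sum_a \sum_(k < N) \sum_i `|(c (T k) a i - c (T k.+1) a i)%:~R| * (n + 1) : R.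
have D10 : 0 <= D1 by rewrite !(mulr_ge0, addr_ge0).
have D20 : 0 <= D2.
  by do 3 (apply: sumr_ge0 => ? _); rewrite mulr_ge0 // addr_ge0.
exists M => e e0.
have den : 0 < N%:R * D1 + D2 + 1 by rewrite ltr_wpDl // addr_ge0 // mulr_ge0.
pose e1 := Num.min 1 (e / (N%:R * D1 + D2 + 1)).
have e10 : 0 < e1 by rewrite lt_min ltr01 divr_gt0.
have e11 : e1 <= 1 by rewrite ge_min lexx.
have e1e : (N%:R * D1 + D2) * e1 <= e.
  have : e1 <= e / (N%:R * D1 + D2 + 1) by rewrite ge_min lexx orbT.
  rewrite ler_pdivlMr // mulrC => h; apply: le_trans h.
  by rewrite ler_wpM2r ?lerDl // ltW.
have d20 : 0 < d / 2 by rewrite divr_gt0.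
have [b0 b01 bP] := beta_expR_small d20 e10.
exists b0 => beta bb; have b1 : 1 <= beta := le_trans b01 bb.
have beta0 : 0 <= beta := le_trans ler01 b1.
pose x := expR (- (beta * (d / 2))).
have x0 : 0 <= x by exact: expR_ge0.
have bx : beta * x <= e1 := bP beta bb.
have xe : x <= e1 by apply: le_trans bx; rewrite ler_peMl.
have [C [tau0 [C0 [tau00 adia]]]] := adiabatic beta con DE DdE cddE DW cdW EP dEP WP.
exists (Num.max tau0 (C / e1)) => tau; rewrite ge_max => /andP[tau0t taue].
move=> rho P crho Drho rho1 rhoP cP DP a.
have taup : 0 < tau := lt_le_trans tau00 tau0t.
have Ct : C / tau <= e1 by rewrite ler_pdivrMr // mulrC -ler_pdivrMr.
have {}adia := adia tau rho tau0t crho Drho rho1 rhoP.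
pose v t i := - tau * drift E W beta rho t i.
pose J a t := tau * (conductance W beta a t * grad (potential E beta rho t) a).
(* [v] is the derivative of [rho], and the opposite of the flux of [J]. *)
have pointwise (k : 'I_N) (t : R) : t \in `]T k, T k.+1[ ->
    `|J a t + \sum_i (c (T k) a i)%:~R * v t i| <= D1 * e1.
  move=> tk; have tk' : t \in `[T k, T k.+1] by move: tk; apply: subset_itv_oo_cc.
  have t01 : t \in `[0, 1] := Tsub k t (ltn_ord k) tk'.
  pose w b := tau * conductance W beta b t.
  have w0 b : 0 < w b by rewrite mulr_gt0 // expR_gt0.
  have JE b : J b t = w b * grad (potential E beta rho t) b by rewrite /J mulrA.
  have fluxE i : flux (fun b => w b * grad (potential E beta rho t) b) i = - v t i.
    rewrite /v mulNr opprK /drift /laplacian /flux mulr_sumr; apply: eq_bigr => b _.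
    by rewrite /w; ring.
  have v_le y i : `|dboltz beta E dE i t| <= y -> `|v t i| <= y + e1.
    move=> dy; have [_ h] := adia i t t01.
    rewrite -(subrK (dboltz beta E dE i t) (v t i)) addrC.
    rewrite (le_trans (ler_normD _ _)) // lerD //; exact: le_trans Ct.
  have sum_v y : (forall i, `|dboltz beta E dE i t| <= y) ->
      \sum_i `|flux (fun b => w b * grad (potential E beta rho t) b) i| <= n * (y + e1).
    by move=> dy; apply: sum_le_card => i; rewrite fluxE normrN v_le.
  have Ln0 : 0 <= 2 * L * n by rewrite !mulr_ge0.
  rewrite /c; case: asboolP => [gE|ngE].
    rewrite big1 ?addr0 => [|i _]; last by rewrite mul0r.
    have gt : gaps (d / 2) (E^~ t) by apply: gaps_near gE => i; exact: closeE.
    rewrite JE (le_trans (ohm_current_le _ _ w0)) //.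
    apply: (le_trans (sum_v _ (fun i => dboltz_gap i beta0 t01 gt))).
    rewrite /D1 -[leRHS]mulrA -[leLHS]mul1r ler_pM ?lerDr //.
      by rewrite mulr_ge0 // addr_ge0 ?mulr_ge0 // ltW.
    rewrite -[leRHS]mulrA ler_wpM2l // [leRHS]mulrDl mul1r lerD2r.
    by rewrite ler_wpM2l.
  have [//|gW] := gapEW (T01 k (ltnW (ltn_ord k))).
  have [Ca H] := lCP _ (oP _ gW) a.
  have -> : J a t + \sum_i ((lC (o (T k))).1 a i)%:~R * v t i =
      w a * grad (potential E beta rho t) a
      - \sum_i ((lC (o (T k))).1 a i)%:~R * flux (fun b => w b * grad (potential E beta rho t) b) i.
    rewrite JE -sumrN; congr (_ + _); apply: eq_bigr => i _.
    by rewrite fluxE mulrN opprK.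
  apply: le_trans (H w (potential E beta rho t) x w0 x0 _) _.
    move=> b b' bb'; have b'b : b' != b by apply: contraTneq bb' => ->; rewrite /o ltxx.
    have := lt_near (closeW k t b' (ltn_ord k) tk') (closeW k t b (ltn_ord k) tk') (gW _ _ b'b) bb'.
    move=> h; rewrite /w mulrCA ler_pM2l // /conductance /x -expRD ler_expR.
    have := ler_wpM2l beta0 h; lra.
  apply: (@le_trans _ _ (Cmax * x * (n * (2 * L * n * beta + e1)))).
    apply: ler_pM => //; rewrite ?mulr_ge0 ?sumr_ge0 //.
      by rewrite ler_wpM2r.
    by apply: sum_v => i; exact: dboltz_le.
  rewrite (_ : Cmax * x * _ = Cmax * (n * (2 * L * n * (beta * x) + x * e1))); last by ring.
  rewrite /D1 -[leRHS]mulrA; apply: ler_pM => //.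
  - by rewrite mulr_ge0 // addr_ge0 ?mulr_ge0 // ltW.
  - by rewrite lerDl.
  rewrite -[leRHS]mulrA ler_wpM2l // [leRHS]mulrDl lerD //; first by rewrite ler_wpM2l.
  by rewrite ler_wpM2r ?(ltW e10) // (le_trans xe).
have piece (k : 'I_N) : `|P a (T k.+1) - P a (T k)
    + \sum_i (c (T k) a i)%:~R * (rho i (T k.+1) - rho i (T k))| <= D1 * e1.
  pose F t := P a t + \sum_i (c (T k) a i)%:~R * rho i t.
  have cF01 : {within `[0, 1], continuous F}.
    apply: within_continuousD => //; apply: within_continuous_sum => i.
    by apply: within_continuousM => // y; exact: cst_continuous.
  have cF : {within `[T k, T k.+1], continuous F}.
    by apply: continuous_subspaceW cF01 => t /= /(Tsub k t (ltn_ord k)).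
  have DF (t : R) : t \in `]T k, T k.+1[ ->
      is_derive t 1 F (J a t + \sum_i (c (T k) a i)%:~R * v t i).
    move=> /(Tsuboo k t (ltn_ord k)) t01.
    have D i : is_derive t 1 (fun t => (c (T k) a i)%:~R * rho i t) ((c (T k) a i)%:~R * v t i).
      have := is_deriveMul (is_derive_cst ((c (T k) a i)%:~R : R) t 1) (Drho i t t01).
      by rewrite mul0r add0r.
    exact: is_deriveD (DP a t t01) (is_deriveSum D).
  have [y yk Fy] := MVT (Tlt k) DF cF.
  have -> : P a (T k.+1) - P a (T k) + \sum_i (c (T k) a i)%:~R * (rho i (T k.+1) - rho i (T k))
      = F (T k.+1) - F (T k).
    rewrite /F opprD addrACA -sumrB; congr (_ + _); apply: eq_bigr => i _.
    by rewrite mulrBr.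
  rewrite Fy normrM -[leRHS]mulr1; apply: ler_pM => //; first exact: pointwise.
  rewrite TS addrAC subrr add0r gtr0_norm ?invr_gt0 // invf_le1 //.
  by rewrite ler1n.
have abel : P a 1 - P a 0 - (M a)%:~R =
    \sum_(k < N) (P a (T k.+1) - P a (T k)
      + \sum_i (c (T k) a i)%:~R * (rho i (T k.+1) - rho i (T k)))
    - \sum_(k < N) \sum_i (c (T k) a i - c (T k.+1) a i)%:~R
        * (rho i (T k.+1) - (ground (T k.+1) i)%:~R).
  have c01 : c 1 = c 0.
    have E01 : E^~ 1 = E^~ 0 by apply/funext => i; rewrite EP.
    have o01 : o 1 = o 0 by apply/funext => b; apply/funext => b'; rewrite /o !WP.
    by rewrite /c E01 o01.
  pose U k := P a (T k) + \sum_i (c (T k) a i)%:~R * rho i (T k).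
  have -> : P a 1 - P a 0 = \sum_(k < N) (U k.+1 - U k).
    rewrite -(big_mkord xpredT (fun k => U k.+1 - U k)) telescope_sumr // /U TN T0 c01.
    by rewrite opprD addrACA [X in _ = _ + X](_ : _ = 0) ?addr0 // -sumrB big1 // => i _;
      rewrite rhoP subrr.
  have -> : (M a)%:~R = - \sum_(k < N) \sum_i
      (c (T k) a i - c (T k.+1) a i)%:~R * (ground (T k.+1) i)%:~R :> R.
    rewrite /M rmorphN rmorph_sum; congr (- _); apply: eq_bigr => k _.
    by rewrite rmorph_sum; apply: eq_bigr => i _; rewrite rmorphM.
  rewrite opprK -big_split -sumrB; apply: eq_bigr => k _ /=.
  rewrite /U opprD addrACA -!addrA; congr (_ + (_ + _)).
  rewrite addrA -!sumrB -big_split; apply: eq_bigr => i _ /=.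
  by rewrite rmorphB /=; ring.
rewrite abel (le_trans (ler_normB _ _)) //; apply: le_trans e1e.
rewrite mulrDl lerD //.
  by rewrite (le_trans (ler_norm_sum _ _ _)) // -mulrA; apply: sum_le_card.
pose D3 b : R := \sum_(k < N) \sum_i `|(c (T k) b i - c (T k.+1) b i)%:~R| * (n + 1).
apply: (@le_trans _ _ (D3 a * e1)); last first.
  rewrite ler_wpM2r ?(ltW e10) //.
  apply: (ler_sum_one (F := D3)) => b.
  by do 2 (apply: sumr_ge0 => ? _); rewrite mulr_ge0 // addr_ge0.
rewrite (le_trans (ler_norm_sum _ _ _)) // mulr_suml; apply: ler_sum => k _.
rewrite (le_trans (ler_norm_sum _ _ _)) // mulr_suml; apply: ler_sum => i _.
rewrite normrM -mulrA.
have [gE|->] := node k (ltn_ord k); last by rewrite subrr normr0 !mul0r.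
rewrite ler_wpM2l //.
rewrite -(subrKA (boltz beta E i (T k.+1))) (le_trans (ler_normD _ _)) //.
rewrite mulrDl mul1r addrC lerD //.
  by rewrite (le_trans (boltz_ground i beta0 d20 gE)) // ler_wpM2l.
have [h _] := adia i _ (T01 _ (ltn_ord k)); exact: le_trans Ct.
Qed.

End Quantization.

(** * Loops, solutions and currents in coordinates *)

Section Bridge.
Variables (R : realType) (G : graph).
Implicit Types (g : loop R G) (rho : R -> 'cV[R]_(nv G)).

Definition Ecoord k g i t : R := (derive1n k g t).1 0 i.
Definition Wcoord k g a t : R := (derive1n k g t).2 0 a.

Lemma is_derive_Ecoord k g i (t : R) :
  is_derive t 1 (Ecoord k g i) (Ecoord k.+1 g i t).
Proof.
have D : is_derive t 1 (derive1n k g) (derive1n k.+1 g t).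
  by apply: DeriveDef; [exact: loop_smooth|rewrite derive1nS derive1E].
apply: (is_derive_functional (u := fun p : params R G => p.1 0 i)) D.
- by move=> x y; rewrite !mxE.
- by move=> c x; rewrite !mxE.
- move=> p; apply: (@continuous_comp _ _ _ fst (fun v : 'rV[R]_(nv G) => v 0 i)).
    exact: cvg_fst.
  exact: coord_continuous.
Qed.

Lemma is_derive_Wcoord k g a (t : R) :
  is_derive t 1 (Wcoord k g a) (Wcoord k.+1 g a t).
Proof.
have D : is_derive t 1 (derive1n k g) (derive1n k.+1 g t).
  by apply: DeriveDef; [exact: loop_smooth|rewrite derive1nS derive1E].
apply: (is_derive_functional (u := fun p : params R G => p.2 0 a)) D.
- by move=> x y; rewrite !mxE.
- by move=> c x; rewrite !mxE.
- move=> p; apply: (@continuous_comp _ _ _ snd (fun v : 'rV[R]_(ne G) => v 0 a)).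
    exact: cvg_snd.
  exact: coord_continuous.
Qed.

Lemma derive1n_periodic k g (t : R) : derive1n k g (t + 1) = derive1n k g t.
Proof.
elim: k t => [|k IH] t; first exact: loop_periodic.
rewrite derive1nS /derive1; set F := (fun h => _); set F' := (fun h => _).
by rewrite (_ : F = F') //; apply/funext => h; rewrite /F addrA !IH.
Qed.

Lemma invmx_ghat beta (g : loop R G) (t : R) : invmx (ghat beta (g t)) =
  diag_mx (\row_a conductance (Wcoord 0 g) beta a t).
Proof.
by apply: invmx_diag => a; rewrite !mxE /conductance /Wcoord /= -expRD mulNr subrr expR0.
Qed.

Lemma ohm_current beta (g : loop R G) rho (t : R) a :
  (invmx (ghat beta (g t)) *m (boundary R G)^T *m kappahat beta (g t) *m rho t) a 0 =
  conductance (Wcoord 0 g) beta a t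
    * grad (potential (Ecoord 0 g) beta (fun i t => rho t i 0) t) a.
Proof.
rewrite -!mulmxA invmx_ghat mul_diag_mx !mxE; congr (_ * _).
rewrite /grad.
have kr i : (kappahat beta (g t) *m rho t) i 0 =
    potential (Ecoord 0 g) beta (fun i t => rho t i 0) t i.
  by rewrite /kappahat mul_diag_mx !mxE.
under eq_bigr do rewrite kr !mxE mulrBl.
rewrite sumrB (bigD1 (d0 a)) //= eqxx mul1r big1 ?addr0 => [|i /negbTE->]; last by rewrite mul0r.
by rewrite (bigD1 (d1 a)) //= eqxx mul1r big1 ?addr0 // => i /negbTE->; rewrite mul0r.
Qed.

Lemma boundary_flux (q : 'cV[R]_(ne G)) i :
  (boundary R G *m q) i 0 = flux (fun a => q a 0) i.
Proof. by rewrite mxE; apply: eq_bigr => a _; rewrite !mxE. Qed.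

Lemma master_drift beta (g : loop R G) rho (t : R) i :
  (master_operator beta (g t) *m rho t) i 0 =
  - drift (Ecoord 0 g) (Wcoord 0 g) beta (fun i t => rho t i 0) t i.
Proof.
rewrite mulNmx mxE -!mulmxA boundary_flux; congr (- flux _ _).
by apply/funext => a; rewrite !mulmxA ohm_current.
Qed.

End Bridge.

Section Limits.
Variables (R : realType) (G : graph).
Implicit Types (g : loop R G) (q : 'cV[R]_(ne G)).

Lemma is_average_current_unique beta tau g q q' :
  is_average_current beta tau g q -> is_average_current beta tau g q' -> q = q'.
Proof.
move=> [rho [prho uniq_rho ->]] [rho' [prho' _ ->]].
apply/matrixP => a j; rewrite !mxE; apply: eq_Rintegral => t.
by rewrite inE => t01; rewrite /current_density (uniq_rho _ prho' t t01).
Qed.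

(** This identifies the limit current of a robust loop with the value that it
    takes on the neighborhood that witnesses robustness. *)
Lemma is_limit_current_unique g q q' :
  is_limit_current g q -> is_limit_current g q' -> q = q'.
Proof.
have analytic_unique beta p p' : is_analytic_current beta g p ->
    is_analytic_current beta g p' -> p = p'.
  move=> [Q Qn Qp] [Q' Qn' Qp']; apply: (norm_cvg_unique Qp).
  apply: cvg_trans Qp'; apply: near_eq_cvg.
  near=> tau; apply: (@is_average_current_unique beta tau g); near: tau; [exact: Qn'|exact: Qn].
move=> [Q Qn Qp] [Q' Qn' Qp']; apply: (norm_cvg_unique Qp).
apply: cvg_trans Qp'; apply: near_eq_cvg.
near=> beta; apply: (analytic_unique beta); near: beta; [exact: Qn'|exact: Qn].
Unshelve. all: by end_near. Qed.

(** The order of the quantifiers is that of the two limits: the threshold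
    [tau0] may depend on [beta]. *)
Lemma limit_current_approx g q (e b0 : R) : 0 < e -> is_limit_current g q ->
  exists2 beta, b0 <= beta & forall tau0 : R, exists2 tau, tau0 <= tau &
  exists2 Q, is_average_current beta tau g Q & forall a, `|q a 0 - Q a 0| <= e.
Proof.
move=> e0 [Qb Qbn Qbq].
have e20 : 0 < e / 2 by rewrite divr_gt0.
move/cvgrPdist_lt : Qbq => /(_ _ e20) Qbq.
have [beta [bb [Qt Qtn Qtb] qb]] := pinfty_witness b0 Qbn Qbq.
exists beta => // tau0; move/cvgrPdist_lt : Qtb => /(_ _ e20) Qtb.
have [tau [tt avg qt]] := pinfty_witness tau0 Qtn Qtb.
exists tau => //; exists (Qt tau) => // a.
rewrite -(subrKA (Qb beta a 0)) (splitr e) (le_trans (ler_normD _ _)) // lerD //.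
  have := coord_le_norm (q - Qb beta) a; rewrite !mxE => h.
  exact: le_trans h (ltW qb).
have := coord_le_norm (Qb beta - Qt tau) a; rewrite !mxE => h.
exact: le_trans h (ltW qt).
Qed.

(** [P] is a primitive of the current, which reduces statements about the
    average current to the mean value theorem. *)
Lemma average_current_scalars beta tau g Q : is_average_current beta tau g Q ->
  exists (rho : 'I_(nv G) -> R -> R) (P : 'I_(ne G) -> R -> R),
  [/\ [/\ forall i, {within `[0, 1], continuous (rho i)},
       forall i (t : R), t \in `]0, 1[ ->
         is_derive t 1 (rho i) (- tau * drift (Ecoord 0 g) (Wcoord 0 g) beta rho t i),
       forall t : R, t \in `[0, 1] -> \sum_i rho i t = 1 &
       forall i, rho i 0 = rho i 1],
   forall a, {within `[0, 1], continuous (P a)},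
   forall a (t : R), t \in `]0, 1[ -> is_derive t 1 (P a)
      (tau * (conductance (Wcoord 0 g) beta a t * grad (potential (Ecoord 0 g) beta rho t) a)) &
   forall a, Q a 0 = P a 1 - P a 0].
Proof.
move=> [rho [[crho Drho rho1 rhoP] _ ->]].
pose r i t := rho t i 0.
have cr i : {within `[0, 1], continuous (r i)}.
  apply: (within_continuous_comp (u := fun v : 'cV[R]_(nv G) => v i 0) crho).
  exact: coord_continuous.
pose J a t := tau * (conductance (Wcoord 0 g) beta a t * grad (potential (Ecoord 0 g) beta r t) a).
have cJ a : {within `[0, 1], continuous (J a)}.
  have cc (c : R) : {within `[0, 1], continuous (fun _ : R => c)}.
    by move=> x; exact: cst_continuous.
  apply: within_continuousM => //; apply: within_continuousM.
    exact: derivable_within (fun t => is_derive_expM (- beta) (is_derive_Wcoord 0 g a t)).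
  have cp i : {within `[0, 1], continuous (fun t => potential (Ecoord 0 g) beta r t i)}.
    apply: within_continuousM => //.
    exact: derivable_within (fun t => is_derive_expM beta (is_derive_Ecoord 0 g i t)).
  by apply: within_continuousD => //; exact: within_continuousN.
have /choice[P PP] a := primitive (cJ a).
exists r, P; split.
- split => //; last by move=> i; rewrite /r rhoP.
  move=> i t t01.
  have := is_derive_functional (u := fun v : 'cV[R]_(nv G) => v i 0) _ _ _ (Drho t t01).
  rewrite mxE master_drift mulrN mulNr; apply => //.
  + by move=> x y; rewrite !mxE.
  + by move=> x y; rewrite !mxE.
  + exact: coord_continuous.
- by move=> a; have [] := PP a.
- by move=> a t t01; have [_ D _] := PP a; exact: D.
- move=> a; have [_ _ ->] := PP a; rewrite mxE; apply: eq_Rintegral => t _.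
  by rewrite /current_density mxE ohm_current.
Qed.

(** The total of [rho] and of the boundary of the transported charge is
    conserved at each vertex, and [rho] is periodic. *)
Lemma average_current_cycle beta tau g Q :
  is_average_current beta tau g Q -> boundary R G *m Q = 0.
Proof.
move=> /average_current_scalars[rho [P [[crho Drho rho1 rhoP] cP DP QP]]].
apply/matrixP => i j; rewrite ord1 boundary_flux mxE.
pose inc a : R := (i == d0 a)%:R - (i == d1 a)%:R.
pose F t := rho i t + \sum_a inc a * P a t.
have cF : {within `[0, 1], continuous F}.
  apply: within_continuousD => //; apply: within_continuous_sum => a.
  by apply: within_continuousM => // x; exact: cst_continuous.
have DF (t : R) : t \in `]0, 1[ -> is_derive t 1 F 0.
  move=> t01.
  have D a : is_derive t 1 (fun t => inc a * P a t) (inc a * (tau *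
      (conductance (Wcoord 0 g) beta a t * grad (potential (Ecoord 0 g) beta rho t) a))).
    by have := is_deriveMul (is_derive_cst (inc a) t 1) (DP a t t01); rewrite mul0r add0r.
  have := is_deriveD (Drho i t t01) (is_deriveSum D) => D'; apply: is_derive_eq.
  rewrite mulNr /drift /laplacian /flux mulr_sumr addrC; apply/eqP; rewrite subr_eq0; apply/eqP.
  by apply: eq_bigr => a _; rewrite mulrCA.
have [c _] := MVT ltr01 DF cF; rewrite mul0r /F rhoP opprD addrACA subrr add0r -sumrB => FE.
by rewrite -[RHS]FE; apply: eq_bigr => a _; rewrite QP mulrBr.
Qed.

Definition shift_loop g (p : params R G) : loop R G.
Proof.
refine (@Loop R G (fun t => g t + p) _ _) => [[|k] t|t].
- exact: (derivableD (@loop_smooth R G g 0 t) (derivable_cst p t 1)).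
- by rewrite derive1n_shift; exact: loop_smooth.
- by rewrite loop_periodic.
Defined.

Lemma shift_loop_ball g (p : params R G) k e : 0 < e -> `|p| < e ->
  Ck_ball g k e (shift_loop g p).
Proof.
move=> e0 pe [|j] t _; first by rewrite /= opprD addNKr normrN.
have -> : derive1n j.+1 (shift_loop g p) = derive1n j.+1 g by exact: derive1n_shift.
by rewrite subrr normr0.
Qed.

End Limits.

Theorem theorem1 (R : realType) (G : graph) (hG : connected_graph G) :
  [set q : 'cV[R]_(ne G) |
     exists2 g : loop R G, intrinsically_robust g & is_limit_current g q]
  `<=` H1_int R G.
Proof.
move=> q [g [U [oU Ug] [q' Uq']] gq].
have {q' Uq'}Uq h : U h -> is_limit_current h q.
  by rewrite (is_limit_current_unique gq (Uq' g Ug)); exact: Uq'.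
have [k [e e0 ballU]] : exists k, exists2 e : R, 0 < e & Ck_ball g k e `<=` U.
  by have : whitney_open U := oU; apply.
have cE1 i : {within `[0, 1], continuous (Ecoord 1 g i)} :=
  derivable_within (is_derive_Ecoord 1 g i).
have cW1 a : {within `[0, 1], continuous (Wcoord 1 g a)} :=
  derivable_within (is_derive_Wcoord 1 g a).
have [L1 L10 EL1] := within_bounded_family cE1.
have [L2 L20 WL2] := within_bounded_family cW1.
pose L := L1 + L2.
have L0 : 0 <= L by exact: addr_ge0.
have EL i (t : R) : t \in `[0, 1] -> `|Ecoord 1 g i t| <= L.
  by move=> t01; rewrite (le_trans (EL1 i t t01)) // lerDl.
have WL a (t : R) : t \in `[0, 1] -> `|Wcoord 1 g a t| <= L.
  by move=> t01; rewrite (le_trans (WL2 a t t01)) // lerDr.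
(* [K] exceeds all the indices, so the translation is shorter than [e]. *)
pose K : R := (nv G + ne G).+1%:R.
have K0 : 0 < K by rewrite ltr0n.
have eta0 : 0 < e / 2 / K by rewrite !divr_gt0.
have [s [r [d [/andP[s0 sb] /andP[r0 rb] dpos gapEW]]]] := generic_shift eta0 L0
  (fun i => derivable_lipschitz (is_derive_Ecoord 0 g i) (EL i))
  (fun a => derivable_lipschitz (is_derive_Wcoord 0 g a) (WL a)).
pose p : params R G := (\row_i (s * i%:R), \row_a (r * a%:R)).
have small (x : R) (j : nat) : 0 <= x -> x < e / 2 / K -> (j < (nv G + ne G).+1)%N ->
    `|x * j%:R| <= e / 2.
  move=> x0 xb jK; rewrite ger0_norm ?mulr_ge0 //.
  apply: (@le_trans _ _ (e / 2 / K * K)); last by rewrite divfK ?gt_eqF.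
  by apply: ler_pM => //; [exact: ltW|rewrite /K ler_nat ltnW].
have pe : `|p| < e.
  apply: (@le_lt_trans _ _ (e / 2)); last by rewrite ltr_pdivrMr // ltr_pMr // ltr1n.
  have e20 : 0 <= e / 2 by rewrite divr_ge0 // ltW.
  have row_le m (v : 'rV[R]_m) : (forall j, `|v 0 j| <= e / 2) -> `|v| <= e / 2.
    move=> ve; rewrite [leLHS]/Num.Def.normr /= mx_normrE.
    by apply: bigmax_le => // -[i j] _ /=; rewrite ord1.
  rewrite prod_normE ge_max; apply/andP; split; apply: row_le => j; rewrite mxE small //.
    by rewrite ltnS (leq_trans (ltnW (ltn_ord j))) // leq_addr.
  by rewrite ltnS (leq_trans (ltnW (ltn_ord j))) // leq_addl.
pose h := shift_loop g p.
have Uh : U h by apply: ballU; exact: shift_loop_ball.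
have hq := Uq h Uh.
have E0 i t : Ecoord 0 h i t = Ecoord 0 g i t + s * i%:R by rewrite /Ecoord /= !mxE.
have W0 a t : Wcoord 0 h a t = Wcoord 0 g a t + r * a%:R by rewrite /Wcoord /= !mxE.
have ES j : Ecoord j.+1 h = Ecoord j.+1 g.
  by apply/funext => i; apply/funext => t; rewrite /Ecoord derive1n_shift.
have WS j : Wcoord j.+1 h = Wcoord j.+1 g.
  by apply/funext => i; apply/funext => t; rewrite /Wcoord derive1n_shift.
have ELh i (t : R) : t \in `[0, 1] -> `|Ecoord 1 h i t| <= L by rewrite ES; exact: EL.
have WLh a (t : R) : t \in `[0, 1] -> `|Wcoord 1 h a t| <= L by rewrite WS; exact: WL.
have EP j i : Ecoord j h i 0 = Ecoord j h i 1.
  by rewrite /Ecoord -[in RHS](add0r 1) derive1n_periodic.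
have WP a : Wcoord 0 h a 0 = Wcoord 0 h a 1.
  by rewrite /Wcoord -[in RHS](add0r 1) derive1n_periodic.
have gaph (t : R) : t \in `[0, 1] -> gaps d ((Ecoord 0 h)^~ t) \/ gaps d ((Wcoord 0 h)^~ t).
  move=> t01; have [gE|gW] := gapEW t t01; [left|right] => i j ij.
    by rewrite !E0; exact: gE.
  by rewrite !W0; exact: gW.
have [M MP] := quantization hG (is_derive_Ecoord 0 h) (is_derive_Ecoord 1 h)
  (fun i => derivable_within (is_derive_Ecoord 2 h i))
  (is_derive_Wcoord 0 h) (fun a => derivable_within (is_derive_Wcoord 1 h a))
  (EP 0) (EP 1) WP L0 dpos ELh
  (fun i => derivable_lipschitz (is_derive_Ecoord 0 h i) (ELh i))
  (fun a => derivable_lipschitz (is_derive_Wcoord 0 h a) (WLh a)) gaph.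
(* The identities to prove hold up to arbitrarily small errors on the
   approximating currents. *)
have eq0 (x C : R) : 0 <= C -> (forall e, 0 < e -> `|x| <= C * e) -> x = 0.
  move=> C0 xe; apply/eqP; rewrite -normr_le0; apply/ler_addgt0Pr => y y0; rewrite add0r.
  have C1 : 0 < C + 1 by rewrite ltr_wpDl.
  apply: le_trans (xe (y / (C + 1)) _) _; first by rewrite divr_gt0.
  by rewrite mulrCA ler_piMr ?(ltW y0) // ler_pdivrMr // mul1r lerDl.
split.
  apply/matrixP => i j; rewrite ord1 boundary_flux [RHS]mxE.
  apply: (eq0 _ _ (ler0n R (ne G))) => y y0.
  have [beta _ /(_ 0)[tau _ [Q avg Qq]]] := limit_current_approx 0 y0 hq.
  have := congr1 (fun v : 'cV[R]_(nv G) => v i 0) (average_current_cycle avg).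
  rewrite boundary_flux [RHS]mxE => FQ.
  rewrite -[X in `|X|]subr0 -FQ /flux -sumrB.
  apply: (le_trans (ler_norm_sum _ _ _)); apply: sum_le_card => a.
  by rewrite -mulrBr normrM -[leRHS]mul1r ler_pM ?incidence_le1.
move=> a; suff -> : q a 0 = (M a)%:~R by exact: intr_int.
apply/eqP; rewrite -subr_eq0; apply/eqP; apply: (eq0 _ 2) => // y y0.
have [b0 b0P] := MP y y0.
have [beta bb H] := limit_current_approx b0 y0 hq.
have [tau0 tau0P] := b0P beta bb.
have [tau tt [Q avg Qq]] := H tau0.
have [rho [P [[crho Drho rho1 rhoP] cP DP QP]]] := average_current_scalars avg.
have Ma := tau0P tau tt rho P crho Drho rho1 rhoP cP DP a.
rewrite -(subrKA (Q a 0)) (le_trans (ler_normD _ _)) // mulr_natl mulr2n lerD //.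
by rewrite QP.
Qed.
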